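(* Let $f:\mathbb{N}\to\mathbb{N}$ be any function with $f(q)/q\to\infty$ as $q\to\infty$. Then there exists a subshift $X$ on a finite alphabet, admitting a nonatomic shift-invariant Borel probability measure $\mu$ that is strongly mixing, such that the word complexity function $p$ of $X$ satisfies $$\lim_{q\to\infty}\frac{p(q)}{f(q)}=0.$$
   Context: A subshift on a finite set $\mathcal{A}$ is a closed (in the product topology), shift-invariant subset $X\subset\mathcal{A}^{\mathbb{Z}}$. Its language $\mathcal{L}(X)$ is the set of finite words occurring as (contiguous) subwords of elements of $X$, and its word complexity function is $p(q)=|\mathcal{L}(X)\cap\mathcal{A}^q|$, the number of words of length $q$ in the language. Let $T$ denote the shift. A shift-invariant probability measure $\mu$ is (strongly) mixing if $\mu(T^nA\cap B)\to\mu(A)\mu(B)$ as $n\to\infty$ for all measurable $A,B\subseteq X$. *)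

(* Defs.v *)
From HB Require Import structures.
From mathcomp Require Import all_boot all_order all_algebra.
From mathcomp Require Import all_classical all_reals all_analysis.

Set Implicit Arguments.
Unset Strict Implicit.
Unset Printing Implicit Defensive.

Import Order.TTheory GRing.Theory Num.Theory.
Import numFieldNormedType.Exports.

Local Open Scope classical_set_scope.
Local Open Scope ring_scope.

(* Alphabets. [measurableType] requires a pointed carrier, hence the
   distinguished letter; it only excludes the empty alphabet, over which there
   are no bi-infinite sequences at all. *)
#[short(type="pfinType")]
HB.structure Definition PointedFinite := {A of Pointed A & Finite A}.
HB.instance Definition _ := Pointed.on bool.
HB.instance Definition _ (n : nat) := isPointed.Build 'I_n.+1 ord0.

Definition full_shift (A : pfinType) : Type :=
  prod_topology (fun _ : int => discrete_topology A).

HB.instance Definition _ (A : pfinType) := Pointed.on (full_shift A).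
HB.instance Definition _ (A : pfinType) := Uniform.on (full_shift A).

Definition borel_shift (A : pfinType) :=
  g_sigma_algebraType (@open (full_shift A)).

Definition shift_map {A : Type} (x : int -> A) : int -> A :=
  fun i => x (i + 1).

Definition subshift {A : pfinType} (X : set (full_shift A)) : Prop :=
  closed X /\ shift_map @` X = X.

Definition language {A : pfinType} (X : set (full_shift A)) : set (seq A) :=
  [set w | exists2 x, X x &
     exists i : int, w = mkseq (fun k => x (i + k%:Z)) (size w)].

Definition complexity {A : pfinType} (X : set (full_shift A)) (q : nat) : nat :=
  #|[pred w : q.-tuple A | `[< language X w >]]|.

Local Open Scope ereal_scope.

Definition atom {d : measure_display} {T : measurableType d} {R : realType}
    (mu : {measure set T -> \bar R}) (A : set T) : Prop :=
  [/\ measurable A, 0 < mu A &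
      forall B, measurable B -> B `<=` A -> mu B < mu A -> mu B = 0].

Definition nonatomic {d : measure_display} {T : measurableType d}
    {R : realType} (mu : {measure set T -> \bar R}) : Prop :=
  forall A, ~ atom mu A.

Definition shift_invariant {A : pfinType} {R : realType}
    (mu : probability (borel_shift A) R) : Prop :=
  forall B : set (borel_shift A), measurable B ->
    mu (shift_map @^-1` B) = mu B.

Definition strongly_mixing {A : pfinType} {R : realType}
    (mu : probability (borel_shift A) R) : Prop :=
  forall B C : set (borel_shift A), measurable B -> measurable C ->
    (fun n => mu ((iter n shift_map @` B) `&` C)) @ \oo --> mu B * mu C.

(* Main.v *)
From HB Require Import structures.
Require Import Defs.
From mathcomp Require Import all_boot all_order all_algebra.
From mathcomp Require Import all_classical all_reals all_analysis.
From mathcomp Require Import zify ring lra.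

Import Order.TTheory GRing.Theory Num.Theory.
Import numFieldNormedType.Exports.

(** Low complexity asks for few words at every scale, mixing asks for words of
    many different lengths.  Both are reconciled by a hierarchy of words
    [word n t], where the type [t] ranges over [0 .. 2 * M n].  All words of
    level [n] share the prefix [x[0, core n)], they have length
    [core n + pad n + t], and [pad n] is negligible against [core n]: so the
    words of one level differ mostly by their length.  A word of level [n + 1]
    is a concatenation of [r n] words of level [n], chosen so that the [i]-th
    core starts at [i * pitch n + a n i] for a displacement [a n i] in
    [[0, M n]], followed by [2 * M n.+1] words of level [n] that tune the total
    length.  The infinite word [x] is the limit of these words, and the subshift
    consists of the configurations all of whose finite subwords occur in [x].

    Complexity ([tower_complexity]).  For [core n <= q <= core n.+1] a subword of
    [x] of length [q] lies in two consecutive words of level [n + 1], so there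
    are at most a constant times [M n.+1 ^ 2 * r n * q] of them.  The parameters
    [M] and [r] have to tend to infinity, but as slowly as desired
    ([quality]); since [f] is superlinear, [M n.+1 ^ 2 * r n] can be kept
    negligible against [f q / q] for all [q >= core n].

    The measure.  Every long stretch of [x] is a concatenation of words of level
    [n], hence of translates of [x[0, core n)] up to a negligible part.  So local
    events have a frequency, uniformly over all windows
    ([tower_uniform_frequency]).  Frequencies of cylinders are consistent, and
    the map sending a point of [[0, 1)] to the branch of the binary tree whose
    nested intervals contain it pushes Lebesgue measure to a probability with
    these values ([tree_measure_exists]).

    Mixing ([tower_mixing]).  Let [core n <= t < core n.+1], write [D] for
    [pitch n], and look at the [p]-th letter of the [i]-th core of a word of
    level [n + 1].  With [p + t = k * D + s], the position [t] further is the
    position [s + a i - a (i + k)] of the [(i + k)]-th core, or a similar position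
    in the next word of level [n + 1].  If the values of [a i - a (i + k)] are so
    spread out over [i] that moving them all by one hardly changes their
    distribution, the average over [i] of a local event [G] at that position is
    an average of [G] over long windows, which is close to the frequency of [G]
    whatever [p] is ([column_sum]).  Summing over [p] gives the decorrelation
    ([block_correlation]).  Since [k] takes all values between [1] and [r n], the
    displacement word must be spread out at every lag at once; a random word is,
    by an exponential moment estimate and a union bound ([exists_spread]).

    Dynkin's theorem extends invariance and mixing from cylinders to Borel sets
    ([dynkin_limit]).  A mixing measure with a set of measure strictly between
    0 and 1 has no atom ([P_nonatomic]). *)

(** * Hierarchical words with nearly common content *)

Section PrefixChain.
Variables (T : eqType) (x0 : T) (L : nat -> seq T).
Hypothesis prefixL : forall k, prefix (L k) (L k.+1).
Hypothesis sizeL : forall k, k < size (L k).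

Lemma prefix_chain_le k l : k <= l -> prefix (L k) (L l).
Proof.
move=> /subnK <-; elim: (l - k) => [|j IH]; first exact: prefix_refl.
by rewrite addSn; apply: prefix_trans IH _.
Qed.

Lemma nth_prefix (s1 s2 : seq T) i : prefix s1 s2 -> i < size s1 ->
  nth x0 s2 i = nth x0 s1 i.
Proof. by move=> /prefixP[s ->] lt; rewrite nth_cat lt. Qed.

Lemma nth_prefix_chain i k : i < size (L k) -> nth x0 (L i) i = nth x0 (L k) i.
Proof.
move=> ik; have [le|lt] := leqP i k.
  by rewrite (nth_prefix _ _ _ (prefix_chain_le _ _ le)).
by rewrite (nth_prefix _ _ _ (prefix_chain_le _ _ (ltnW lt))).
Qed.
End PrefixChain.

Section Tower.
Variables (M r : nat -> nat) (a : nat -> nat -> nat).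

(** The length of the common prefix of the words of level [n], paired with the
    least number of letters that follow it.  The base level is
    [word 0 t = false :: nseq t true]. *)
Fixpoint core_pad n : nat * nat :=
  if n is m.+1 then
    (r m * ((core_pad m).1 + (core_pad m).2 + M m),
     2 * M m.+1 * ((core_pad m).1 + (core_pad m).2))
  else (1, 0).
Definition core n := (core_pad n).1.
Definition pad n := (core_pad n).2.
Definition pitch n := core n + pad n + M n.

Lemma coreS n : core n.+1 = r n * pitch n. Proof. by []. Qed.
Lemma padS n : pad n.+1 = 2 * M n.+1 * (core n + pad n). Proof. by []. Qed.

(** The types of the subwords.  The first [r n] ones put the [i]-th core at
    [i * pitch n + a n i].  The last [2 * M n.+1] are [t] ones followed by zeros,
    so that their contribution to the length is a constant plus [t]. *)
Definition tau n t : seq nat :=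
  [seq M n + a n i.+1 - a n i | i <- iota 0 (r n)] ++
  nseq t 1 ++ nseq (2 * M n.+1 - t) 0.

Fixpoint word n t : seq bool :=
  if n is m.+1 then flatten (map (word m) (tau m t)) else false :: nseq t true.

Hypothesis a_le : forall n i, a n i <= M n.
Hypothesis a_first : forall n, a n 0 = 0.
Hypothesis a_last : forall n, a n (r n) = 0.
Hypothesis M_gt2 : forall n, 2 < M n.
Hypothesis r_gt1 : forall n, 1 < r n.

Definition is_type n : pred nat := fun t => t <= 2 * M n.

Lemma sumn_gaps n i :
  sumn [seq M n + a n j.+1 - a n j | j <- iota 0 i] = i * M n + a n i.
Proof.
elim: i => [|i IH]; first by rewrite /= a_first.
rewrite -addn1 iotaD map_cat sumn_cat IH /= add0n addn0.
by have := a_le n i; have := a_le n (i + 1); rewrite addn1; nia.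
Qed.

Lemma all_tau n t : all (is_type n) (tau n t).
Proof.
rewrite !all_cat; apply/and3P; split.
- apply/allP => _ /mapP[i _ ->]; rewrite /is_type.
  by have := a_le n i; have := a_le n i.+1; lia.
- by apply/allP => i /nseqP[-> _]; rewrite /is_type; have := M_gt2 n; lia.
- by apply/allP => i /nseqP[-> _]; rewrite /is_type.
Qed.

Lemma size_flatten_words n s :
  (forall t, is_type n t -> size (word n t) = core n + pad n + t) ->
  all (is_type n) s ->
  size (flatten (map (word n) s)) = size s * (core n + pad n) + sumn s.
Proof.
move=> sz; elim: s => [|t s IH] //= /andP[tt st].
by rewrite size_cat sz // IH // mulSn; lia.
Qed.

(** The displacements telescope and [a n] vanishes at both ends, so the first
    [r n] subwords have total length [core n.+1] exactly. *)
Lemma size_word n t : is_type n t -> size (word n t) = core n + pad n + t.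
Proof.
elim: n t => [|n IH] t tt; first by rewrite /= size_nseq.
rewrite /= size_flatten_words ?all_tau //.
rewrite !size_cat !sumn_cat size_map size_iota !size_nseq sumn_gaps !sumn_nseq a_last.
by rewrite coreS padS /pitch; move: tt; rewrite /is_type; nia.
Qed.

Definition size_words n s := @size_flatten_words n s (size_word n).

Lemma tau_split n t i : i < r n -> exists s,
  tau n t = [seq M n + a n j.+1 - a n j | j <- iota 0 i] ++
            (M n + a n i.+1 - a n i) :: s.
Proof.
move=> ir; rewrite /tau.
have -> : iota 0 (r n) = iota 0 i ++ i :: iota i.+1 (r n - i.+1).
  by rewrite -[i :: _]/(iota i (r n - i.+1).+1) -iotaD; congr iota; lia.
by rewrite map_cat -catA /=; eexists.
Qed.

Lemma all_gaps n i : all (is_type n) [seq M n + a n j.+1 - a n j | j <- iota 0 i].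
Proof.
apply/allP => _ /mapP[j _ ->]; rewrite /is_type.
by have := a_le n j; have := a_le n j.+1; lia.
Qed.

(** The first [r n] subwords of a word of level [n + 1] do not depend on its
    type. *)
Lemma nth_core n t p : p < core n -> nth false (word n t) p = nth false (word n 0) p.
Proof.
case: n => [|n]; first by case: p.
move=> pc; rewrite /= /tau !map_cat !flatten_cat !(nth_cat _ (flatten _)).
rewrite size_words ?all_gaps // size_map size_iota sumn_gaps a_last.
have pE : p < r n * (core n + pad n) + (r n * M n + 0).
  by move: pc; rewrite coreS /pitch; nia.
by rewrite !pE.
Qed.

Lemma nth_subcore n t i p : i < r n -> p < core n ->
  nth false (word n.+1 t) (i * pitch n + a n i + p) = nth false (word n 0) p.
Proof.
move=> ir pc /=; have [s ->] := tau_split n t i ir.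
rewrite map_cat flatten_cat nth_cat size_words ?all_gaps //.
rewrite size_map size_iota sumn_gaps ifF; last by rewrite /pitch; lia.
have -> : i * pitch n + a n i + p - (i * (core n + pad n) + (i * M n + a n i)) = p.
  by rewrite /pitch; lia.
rewrite /= nth_cat size_word; last first.
  by rewrite /is_type; have := a_le n i; have := a_le n i.+1; lia.
by rewrite ifT ?nth_core //; lia.
Qed.

(** The type of the first subword of every word of level [n + 1]. *)
Definition first_type n := M n + a n 1.

Lemma first_type_is_type n : is_type n (first_type n).
Proof. by rewrite /is_type /first_type; have := a_le n 1; lia. Qed.

(** The types, at level [n], of the subwords that make up
    [word (n + k) (first_type (n + k))].  For fixed [n] they form a chain of
    prefixes, which is what makes the limit below exist at all levels at once. *)
Fixpoint types n k : seq nat :=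
  if k is j.+1 then flatten (map (tau n) (types n.+1 j)) else [:: first_type n].

Lemma tau_head n t : exists s, tau n t = first_type n :: s.
Proof.
have [|s ->] := tau_split n t 0; first by apply: leq_trans (r_gt1 n).
by rewrite /= a_first subn0; exists s.
Qed.

Lemma all_types n k : all (is_type n) (types n k).
Proof.
case: k => [|k] /=; first by rewrite first_type_is_type.
by elim: (types _ _) => [|t s IH] //=; rewrite all_cat all_tau.
Qed.

Lemma flatten_types n k :
  flatten (map (word n) (types n k)) = word (n + k) (first_type (n + k)).
Proof.
elim: k n => [|k IH] n; first by rewrite /= cats0 addn0.
rewrite /= addnS -addSn -IH.
by elim: (types n.+1 k) => [|t s IHs] //=; rewrite map_cat flatten_cat IHs.
Qed.

Lemma prefix_types n k : prefix (types n k) (types n k.+1).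
Proof.
elim: k n => [|k IH] n.
  by have [s /= ->] := tau_head n (first_type n.+1); rewrite cats0 prefix_cons eqxx prefix0s.
have /prefixP[s /= ->] := IH n.+1.
by rewrite map_cat flatten_cat prefix_prefix.
Qed.

(** A word of level [n + 1] has at least two subwords, so the chain of prefixes
    is unbounded. *)
Lemma size_types n k : k < size (types n k).
Proof.
elim: k n => [|k IH] n //=; apply: leq_ltn_trans (IH n.+1) _.
have : 0 < size (types n.+1 k) by apply: leq_ltn_trans (IH n.+1).
have le s : size s <= size (flatten (map (tau n) s)).
  elim: s => [|t s IHs] //=; rewrite size_cat.
  by have [u ->] := tau_head n t => /=; lia.
have two t : 1 < size (tau n t).
  by rewrite !size_cat size_map size_iota; have := r_gt1 n; lia.
case: (types n.+1 k) => [|t s] // _ /=.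
by rewrite size_cat; have := two t; have := le s; lia.
Qed.

Lemma core_gt n : n < core n.
Proof.
elim: n => [|n IH] //; rewrite coreS /pitch; have := r_gt1 n; nia.
Qed.

Definition limit_word i : bool := nth false (word i (first_type i)) i.

Lemma limit_wordE n i : i < size (word n (first_type n)) ->
  limit_word i = nth false (word n (first_type n)) i.
Proof.
apply: (nth_prefix_chain _ _ (fun n => word n (first_type n))) => k.
- have := flatten_types k 1; rewrite addn1 => <-.
  have [s /= ->] := tau_head k (first_type k.+1).
  by rewrite cats0 /= prefix_prefix.
- by rewrite size_word ?first_type_is_type //; have := core_gt k; lia.
Qed.

Lemma limit_word_core n p : p < core n -> limit_word p = nth false (word n 0) p.
Proof.
move=> pc; rewrite (limit_wordE n) ?nth_core //.
by rewrite size_word ?first_type_is_type //; lia.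
Qed.

Definition type_at n m := nth 0 (types n m) m.
Definition cut n m := \sum_(i < m) (core n + pad n + type_at n i).

Lemma cutS n m : cut n m.+1 = cut n m + (core n + pad n + type_at n m).
Proof. exact: big_ord_recr. Qed.

Lemma type_atE n k m : m < size (types n k) -> nth 0 (types n k) m = type_at n m.
Proof.
by move=> mk; rewrite /type_at -(nth_prefix_chain _ _ _ (prefix_types n) (size_types n) m k).
Qed.

Lemma type_at_is_type n m : is_type n (type_at n m).
Proof. by apply: (allP (all_types n m)); rewrite mem_nth ?size_types. Qed.

(** The limit word is, for every [n], the concatenation of the words of level
    [n] of types [type_at n 0], [type_at n 1], and so on. *)
Lemma limit_word_cut n m i : i < core n + pad n + type_at n m ->
  limit_word (cut n m + i) = nth false (word n (type_at n m)) i.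
Proof.
move=> iw; have mk := size_types n m.
have sz : size (flatten (map (word n) (take m (types n m)))) = cut n m.
  rewrite size_words; last by apply/allP => t /mem_take; apply: (allP (all_types n m)).
  rewrite size_takel ?(ltnW mk) // /cut big_split /= sum_nat_const card_ord; congr (_ + _).
  rewrite sumnE (big_nth 0) size_takel ?(ltnW mk) // big_mkord; apply: eq_bigr => j _.
  by rewrite nth_take // type_atE // (ltn_trans _ mk).
have E : flatten (map (word n) (types n m)) =
    flatten (map (word n) (take m (types n m))) ++
    word n (type_at n m) ++ flatten (map (word n) (drop m.+1 (types n m))).
  rewrite -{1}(cat_take_drop m (types n m)) map_cat flatten_cat.
  by rewrite (drop_nth 0 mk) /= type_atE.
have sw : size (word n (type_at n m)) = core n + pad n + type_at n m.
  by rewrite size_word ?type_at_is_type.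
rewrite (limit_wordE (n + m)) -flatten_types E; last first.
  by rewrite !size_cat sz sw; lia.
rewrite nth_cat sz ifF; last by lia.
by rewrite addKn nth_cat sw iw.
Qed.

Lemma limit_word_cut_core n m p : p < core n -> limit_word (cut n m + p) = limit_word p.
Proof.
move=> pc; rewrite limit_word_cut; last by lia.
by rewrite nth_core // (limit_word_core n).
Qed.

(** This is where the displacements become visible in the limit word: behind
    every cut of level [n + 1] there are [r n] copies of the prefix of length
    [core n]. *)
Lemma limit_word_cut_subcore n m i p : i < r n -> p < core n ->
  limit_word (cut n.+1 m + (i * pitch n + a n i + p)) = limit_word p.
Proof.
move=> ir pc; rewrite limit_word_cut.
  by rewrite nth_subcore // (limit_word_core n).
have : i * pitch n + pitch n <= r n * pitch n by nia.
by rewrite coreS; have := a_le n i; rewrite /pitch; lia.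
Qed.

End Tower.

Local Open Scope classical_set_scope.
Local Open Scope ring_scope.

(** * Displacement words with spread-out differences *)

(** How many pairs at lag [d] have their difference, moved by [u], in the set
    [phi].  The summand [M] keeps the difference of letters at most [M]
    nonnegative. *)
Definition lag_count (a : nat -> nat) M n d (phi : nat -> bool) (u : nat) : nat :=
  (\sum_(i < n - d) phi (M + a (i + d) - a i + u))%N.
(** At every positive lag, the distribution of the differences is within
    [2 / e] of its translate by one, in total variation.  An inequality in one
    direction suffices because [phi] may be replaced by its complement. *)
Definition spread_word (e M r : nat) (a : nat -> nat) :=
  forall d phi, (0 < d)%N ->
    (e * lag_count a M r d phi 0 <= e * lag_count a M r d phi 1 + 2 * r)%N.

Section Chernoff.
Variable R : archiRealFieldType.

(** Up to the factor [M ^ k], the expectation of [f] at a uniformly random word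
    of [k] letters below [M].  The nesting lets the first letter be integrated
    alone, given the others. *)
Fixpoint word_sum (M k : nat) (f : seq nat -> R) : R :=
  if k is k'.+1 then \sum_(z < M) word_sum M k' (fun s => f (nat_of_ord z :: s))
  else f [::].

Lemma le_word_sum M k (f g : seq nat -> R) :
  (forall s, size s = k -> all (ltn^~ M) s -> f s <= g s) ->
  word_sum M k f <= word_sum M k g.
Proof.
elim: k f g => [|k IH] f g fg /=; first exact: fg.
apply: ler_sum => z _; apply: IH => s sk sM.
by apply: fg => /=; rewrite ?sk // ltn_ord.
Qed.

Lemma word_sum_cst M k c : word_sum M k (fun _ => c) = M%:R ^+ k * c.
Proof.
elim: k => [|k IH] /=; first by rewrite expr0 mul1r.
by rewrite (eq_bigr _ (fun z _ => IH)) sumr_const card_ord exprS -mulrA mulr_natl.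
Qed.

Lemma word_sum_scale M k c f :
  word_sum M k (fun s => c * f s) = c * word_sum M k f.
Proof.
elim: k f => [|k IH] f //=.
by rewrite mulr_sumr; apply: eq_bigr => z _; rewrite IH.
Qed.

Lemma word_sum_exchange M k (I : finType) (F : I -> seq nat -> R) :
  word_sum M k (fun s => \sum_i F i s) = \sum_i word_sum M k (F i).
Proof.
elim: k F => [|k IH] F //=.
rewrite exchange_big /=; apply: eq_bigr => z _.
by rewrite (IH (fun i s => F i (nat_of_ord z :: s))).
Qed.

(** The probabilistic method: a function of expectation below 1 takes a value
    below 1. *)
Lemma word_sum_lt1 M k f : word_sum M k f < M%:R ^+ k ->
  exists s, [/\ size s = k, all (ltn^~ M) s & f s < 1].
Proof.
elim: k f => [|k IH] f /=; first by rewrite expr0 => f1; exists [::].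
move=> fM.
have [z zlt] : exists z : 'I_M,
    word_sum M k (fun s => f (nat_of_ord z :: s)) < M%:R ^+ k.
  apply/existsP; rewrite -[X in is_true X]negbK; apply/negP => /existsPn nlt.
  move: fM; rewrite ltNge => /negP; apply.
  have -> : M%:R ^+ k.+1 = \sum_(z < M) (M%:R ^+ k) :> R.
    by rewrite sumr_const card_ord exprS mulr_natl.
  by apply: ler_sum => z _; rewrite leNgt nlt.
have [s [sk sM f1]] := IH _ zlt.
by exists (nat_of_ord z :: s); split => //=; rewrite ?sk // sM ltn_ord.
Qed.

Definition step_weight (q : R) (b1 b2 : bool) : R := q ^+ b1 / q ^+ b2.

(** The exponential of the difference of two lag counts, written as a product
    over the pairs at lag [d] (see [lag_weight_counts]). *)
Definition lag_weight q M d (phi : nat -> bool) (s : seq nat) : R :=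
  \prod_(i < size s - d)
    step_weight q (phi (M + nth 0%N s (i + d) - nth 0%N s i)%N)
                  (phi (M + nth 0%N s (i + d) - nth 0%N s i).+1).

Lemma step_weight_ge0 q b1 b2 : 0 <= q -> 0 <= step_weight q b1 b2.
Proof. by move=> q0; rewrite divr_ge0 ?exprn_ge0. Qed.

Lemma lag_weight_ge0 q M d phi s : 0 <= q -> 0 <= lag_weight q M d phi s.
Proof. by move=> q0; apply: prodr_ge0 => i _; apply: step_weight_ge0. Qed.

Lemma lag_weight_counts q M d phi s : 0 < q ->
  lag_weight q M d phi s =
  q ^+ lag_count (nth 0%N s) M (size s) d phi 0 /
  q ^+ lag_count (nth 0%N s) M (size s) d phi 1.
Proof.
move=> q0; rewrite /lag_weight /lag_count.
elim: (size s - d)%N => [|n IH]; first by rewrite !big_ord0 expr0 divr1.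
rewrite !big_ord_recr /= IH /step_weight addn0 addn1 !exprD; field.
by rewrite !expf_neq0 ?gt_eqF.
Qed.

(** A new first letter enters exactly one pair at lag [d]. *)
Lemma lag_weight_cons q M d phi z s : (0 < d <= size s)%N ->
  lag_weight q M d phi (z :: s) =
  step_weight q (phi (M + nth 0%N s d.-1 - z)%N) (phi (M + nth 0%N s d.-1 - z).+1)
  * lag_weight q M d phi s.
Proof.
move=> /andP[d0 ds]; rewrite /lag_weight /= subSn // big_ord_recl /=.
by case: d d0 ds.
Qed.

Lemma lag_weight_short q M d phi s : (size s <= d)%N -> lag_weight q M d phi s = 1.
Proof. by rewrite -subn_eq0 /lag_weight => /eqP ->; rewrite big_ord0. Qed.

Lemma step_weight_le (l : R) b1 b2 : 0 <= l ->
  step_weight (1 + l) b1 b2 <= 1 + l * (b1%:R - b2%:R) + l ^+ 2.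
Proof.
move=> l0; have p : 0 < 1 + l by rewrite ltr_pwDl.
rewrite /step_weight ler_pdivrMr ?exprn_gt0 //.
have := mulr_ge0 l0 (mulr_ge0 l0 l0).
have := mulr_ge0 l0 l0.
case: b1; case: b2; rewrite /= ?expr1 ?expr0; nra.
Qed.

(** To first order in [l] the sum over the letter [z] telescopes to at most 1;
    only the second-order term is of size [M].  This is the gain that makes the
    exponential moment grow slowly. *)
Lemma sum_step_weight M (l : R) (phi : nat -> bool) y : (0 < M)%N -> 0 <= l ->
  \sum_(z < M) step_weight (1 + l) (phi (M + y - z)%N) (phi (M + y - z).+1)
    <= M%:R * (1 + l / M%:R + l ^+ 2).
Proof.
move=> M0 l0.
apply: le_trans (_ : \sum_(z < M) (1 + l * ((phi (M + y - z)%N)%:R -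
    (phi (M + y - z).+1)%:R) + l ^+ 2) <= _).
  by apply: ler_sum => z _; apply: step_weight_le.
have tele n : (n <= M)%N ->
    \sum_(z < n) (((phi (M + y - z)%N)%:R - (phi (M + y - z).+1)%:R) : R)
    = (phi (M + y - n).+1)%:R - (phi (M + y).+1)%:R.
  elim: n => [|n IH] nM; first by rewrite big_ord0 subn0 subrr.
  rewrite big_ord_recr /= IH 1?ltnW //.
  have -> : (M + y - n = (M + y - n.+1).+1)%N by lia.
  by ring.
rewrite !big_split /= -mulr_sumr tele // !sumr_const card_ord.
rewrite -[l ^+ 2 *+ M]mulr_natl !mulrDr mulr1 lerD2r lerD2l mulrCA.
rewrite mulfV ?pnatr_eq0 -?lt0n // -mulrDr ler_wpM2l //.
by case: (phi _); case: (phi _) => /=; lra.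
Qed.

(** The letters are integrated one at a time, each costing a factor
    [1 + l / M + l ^ 2] by [sum_step_weight]. *)
Lemma word_sum_lag_weight M (l : R) phi d k : (0 < M)%N -> (0 < d)%N -> 0 <= l ->
  word_sum M k (lag_weight (1 + l) M d phi) <=
  M%:R ^+ k * (1 + l / M%:R + l ^+ 2) ^+ k.
Proof.
move=> M0 d0 l0; set x := _ + _ + _.
have x1 : 1 <= x.
  by rewrite /x -addrA lerDl addr_ge0 ?divr_ge0 ?exprn_ge0.
elim: k => [|k IH].
  by rewrite /= lag_weight_short // !expr0 mulr1.
have [kd|dk] := ltnP k d.
  apply: le_trans (_ : word_sum M k.+1 (fun=> 1) <= _).
    by apply: le_word_sum => s sk _; rewrite lag_weight_short // sk.
  by rewrite word_sum_cst ler_wpM2l ?exprn_ge0 // exprn_ege1.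
have swap f : word_sum M k.+1 f =
    word_sum M k (fun s => \sum_(z < M) f (nat_of_ord z :: s)).
  by rewrite (word_sum_exchange M k 'I_M (fun z s => f (nat_of_ord z :: s))).
rewrite swap.
apply: le_trans (_ : word_sum M k
    (fun s => (M%:R * x) * lag_weight (1 + l) M d phi s) <= _).
  apply: le_word_sum => s sk sM.
  under eq_bigr do rewrite lag_weight_cons ?sk ?d0 //.
  rewrite -mulr_suml ler_wpM2r ?lag_weight_ge0 ?addr_ge0 //.
  exact: sum_step_weight.
rewrite word_sum_scale !exprS.
have -> : M%:R * M%:R ^+ k * (x * x ^+ k) = M%:R * x * (M%:R ^+ k * x ^+ k) by ring.
by rewrite ler_wpM2l // mulr_ge0 // (le_trans _ x1).
Qed.

Lemma bernoulli_inequality (x : R) n : 0 <= x -> 1 + n%:R * x <= (1 + x) ^+ n.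
Proof.
move=> x0; elim: n => [|n IH]; first by rewrite mul0r addr0 expr0.
rewrite exprS; apply: le_trans (ler_wpM2l _ IH); last by rewrite addr_ge0.
have := mulr_ge0 (ler0n R n) (mulr_ge0 x0 x0).
by rewrite -[n.+1%:R]natr1; nra.
Qed.

(** Bernoulli's inequality at half the exponent, then squared. *)
Lemma geometric_beats_linear (y C : R) (k0 : nat) : 1 < y -> 0 <= C ->
  exists2 k, (k0 <= k)%N & C * k.+1%:R < y ^+ k.
Proof.
move=> y1 C0; set x := y - 1; have x0 : 0 < x by rewrite subr_gt0.
pose m := (Num.Def.trunc (4 * C / x ^+ 2)%R + k0).+1.
have hm : 4 * C / x ^+ 2 < m%:R.
  by apply: (lt_le_trans (truncnS_gt _)); rewrite ler_nat /m ltnS leq_addr.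
have k0m : (k0 < m)%N by rewrite /m ltnS leq_addl.
clearbody m; exists (2 * m)%N; first by lia.
have b := bernoulli_inequality x m (ltW x0).
have {b}b : m%:R * x <= y ^+ m.
  have <- : 1 + x = y by rewrite /x addrC subrK.
  by apply: le_trans b; rewrite lerDr.
rewrite mulnC exprM.
apply: lt_le_trans (_ : (m%:R * x) ^+ 2 <= _); last first.
  by rewrite lerXn2r // nnegrE ?mulr_ge0 ?exprn_ge0 ?(ltW x0) //; lra.
move: hm; rewrite ltr_pdivrMr ?exprn_gt0 // => hm.
have m1 : 1 <= m%:R :> R by rewrite ler1n; lia.
have : m%:R * (4 * C) < m%:R * (m%:R * x ^+ 2) by rewrite ltr_pM2l // ltr0n; lia.
rewrite -[(m * 2).+1%:R]natr1 natrM exprMn.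
have : C * 1 <= C * m%:R by rewrite ler_wpM2l.
set p := m%:R in m1 *; set z := x ^+ 2; lra.
Qed.

(** With [l = 1 / (4 e)] and [M = 4 e], the moment gained over [e] letters is
    less than the factor [1 + l] lost by one unit of excess. *)
Lemma chernoff_rate e (x : R) : (0 < e)%N -> 0 <= x -> x <= 1 / (8 * e%:R ^+ 2) ->
  (1 + x) ^+ e < 1 + 1 / (4 * e%:R).
Proof.
move=> e0 x0 xe.
have e1 : 1 <= e%:R :> R by rewrite ler1n.
have ep : 0 < e%:R :> R by lra.
have p : e%:R * x <= 1 / (8 * e%:R).
  apply: le_trans (ler_wpM2l _ xe) _; first by lra.
  by rewrite le_eqVlt; apply/orP; left; apply/eqP; field; lra.
set y := 1 / (8 * e%:R) in p *.
have y18 : y <= 1 / 8.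
  by rewrite /y !mul1r lef_pV2 ?posrE; nra.
have yE : 1 / (4 * e%:R) = 2 * y :> R by rewrite /y; field; lra.
have y0 : 0 < y by rewrite /y divr_gt0 ?mulr_gt0.
rewrite yE.
(* (1 + x)^k <= 1 / (1 - k x), and at k = e this is at most 1 / (1 - y) < 1 + 2 y *)
have key k : (k <= e)%N -> (1 + x) ^+ k * (1 - k%:R * x) <= 1.
  elim: k => [|k IH] ke; first by rewrite expr0 mul0r subr0 mulr1.
  apply: le_trans (IH (ltnW ke)).
  rewrite exprSr -mulrA ler_wpM2l ?exprn_ge0 ?addr_ge0 //.
  have := mulr_ge0 (ler0n R k) (mulr_ge0 x0 x0).
  have := mulr_ge0 x0 x0.
  by rewrite -natr1; nra.
have := key e (leqnn e); set Y := _ ^+ e => kY.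
have Yp : 0 < Y by rewrite exprn_gt0 // ltr_pwDl.
nra.
Qed.

Lemma eq_lag_count a b M n d (phi psi : nat -> bool) u :
  (forall i, (i < n - d)%N ->
     phi (M + a (i + d) - a i + u)%N = psi (M + b (i + d) - b i + u)%N) ->
  lag_count a M n d phi u = lag_count b M n d psi u.
Proof. by move=> ab; apply: eq_bigr => i _; rewrite ab. Qed.

(** Markov's inequality bounds the proportion of words that violate the
    conclusion at a given lag and a given set by a geometric term in [k].  The
    number of lags is linear in [k], and only sets of integers up to [2 * M]
    matter, so the union bound succeeds for large [k]. *)
Lemma exists_spread_word e n0 : (0 < e)%N -> exists k s,
  [/\ (n0 <= k)%N, size s = (e * k)%N, all (ltn^~ (4 * e)%N) s &
      forall d phi, (0 < d)%N ->
        (lag_count (nth 0%N s) (4 * e) (size s) d phi 0 <=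
         lag_count (nth 0%N s) (4 * e) (size s) d phi 1 + k)%N].
Proof.
move=> e0; set M := (4 * e)%N; have M0 : (0 < M)%N by rewrite /M; lia.
have e1 : 1 <= e%:R :> R by rewrite ler1n.
pose l : R := 1 / (4 * e%:R).
have l0 : 0 < l by rewrite /l divr_gt0; lra.
pose x : R := l / M%:R + l ^+ 2.
have xE : x = 1 / (8 * e%:R ^+ 2).
  by rewrite /x /M /l natrM; field; lra.
pose y := (1 + l) / (1 + x) ^+ e.
have x0 : 0 <= x by rewrite xE divr_ge0 ?mulr_ge0 ?exprn_ge0.
have y1 : 1 < y.
  have xp : 0 < (1 + x) ^+ e by rewrite exprn_gt0 // ltr_pwDl.
  by rewrite /y ltr_pdivlMr // mul1r; apply: chernoff_rate => //; rewrite xE.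
pose I := {ffun 'I_(2 * M).+1 -> bool}.
pose ext (f : I) (v : nat) := f (inord v).
have [k k0 kP] := geometric_beats_linear y (#|I| * e)%:R (n0.+1) y1 (ler0n _ _).
have kpos : (0 < k)%N by apply: leq_trans k0.
pose r := (e * k)%N.
(* Markov: F i s is at least 1 as soon as s violates the bound for the pair i *)
pose F (i : 'I_r * I) (s : seq nat) : R :=
  (1 + l) ^- k * lag_weight (1 + l) M i.1.+1 (ext i.2) s.
have lp : 0 < 1 + l by lra.
have [|s [sr sM Fs]] := word_sum_lt1 M r (fun s => \sum_i F i s).
  rewrite word_sum_exchange.
  apply: le_lt_trans (_ : \sum_(i : 'I_r * I)
      (1 + l) ^- k * (M%:R ^+ r * (1 + x) ^+ r) < _).
    apply: ler_sum => i _; rewrite word_sum_scale ler_wpM2l ?invr_ge0 ?exprn_ge0 ?(ltW lp) //.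
    by rewrite /x addrA; apply: word_sum_lag_weight => //; exact: ltW.
  rewrite sumr_const card_prod card_ord.
  have Mr : 0 < M%:R ^+ r :> R by rewrite exprn_gt0 // ltr0n.
  have -> : (1 + l) ^- k * (M%:R ^+ r * (1 + x) ^+ r) *+ (r * #|I|) =
      M%:R ^+ r * ((r * #|I|)%:R * ((1 + x) ^+ r / (1 + l) ^+ k)).
    by rewrite -[LHS]mulr_natl; ring.
  rewrite -[ltRHS]mulr1.
  rewrite ltr_pM2l //.
  have -> : (1 + x) ^+ r / (1 + l) ^+ k = (y ^+ k)^-1.
    by rewrite /y expr_div_n invf_div /r exprM.
  rewrite ltr_pdivrMr ?mul1r ?exprn_gt0 //; last by lra.
  apply: le_lt_trans kP.
  rewrite -natrM ler_nat /r; nia.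
exists k, s; split=> //; first by lia.
move=> d phi d0; rewrite sr.
have [dr|rd] := ltnP d r; last first.
  by rewrite /lag_count (_ : e * k - d = 0)%N ?big_ord0 //; rewrite /r in rd; lia.
have dlt : (d.-1 < r)%N by lia.
pose f : I := [ffun v : 'I__ => phi v].
have sb i : (nth 0%N s i < M)%N.
  have [ir|ri] := ltnP i (size s); last by rewrite nth_default.
  exact: (allP sM _ (mem_nth 0%N ir)).
have ephi u : (u <= 1)%N -> lag_count (nth 0%N s) M r d phi u =
    lag_count (nth 0%N s) M r d (ext f) u.
  move=> u1; apply: eq_lag_count => i _; rewrite /ext ffunE inordK //.
  by have := sb (i + d)%N; have := sb i; lia.
rewrite !ephi // leqNgt; apply/negP => bad.
have : F (Ordinal dlt, f) s < 1.
  apply: le_lt_trans Fs; rewrite (bigD1 (Ordinal dlt, f)) //= lerDl.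
  apply: sumr_ge0 => i _; rewrite mulr_ge0 ?lag_weight_ge0 ?invr_ge0 ?exprn_ge0 //;
    exact: ltW lp.
rewrite /F /= prednK // lag_weight_counts // sr.
set A := lag_count _ _ _ _ _ 0 in bad *; set B := lag_count _ _ _ _ _ 1 in bad *.
rewrite mulrC -mulrA -invfM ltr_pdivrMr ?mulr_gt0 ?exprn_gt0 // mul1r -exprD.
rewrite ltNge => /negP; apply; apply: ler_weXn2l; last by lia.
by lra.
Qed.

End Chernoff.

(** Prepending the letter 0 and reading 0 past the end changes every lag count
    by at most one. *)
Lemma exists_spread e n0 : (0 < e)%N -> exists r a,
  [/\ (n0 <= r)%N, (forall i, (a i <= 4 * e)%N), a 0%N = 0%N, a r = 0%N &
      spread_word e (4 * e) r a].
Proof.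
move=> e0; have [k [s [k0 sk sM sP]]] := exists_spread_word rat e (n0 + 1) e0.
exists (size s).+1, (nth 0%N (0%N :: s)); split => //.
- by rewrite sk; nia.
- case=> [|i] //=; have [ir|ri] := ltnP i (size s); last by rewrite nth_default.
  exact: ltnW (allP sM _ (mem_nth 0%N ir)).
- by rewrite nth_default.
move=> d phi d0.
set a := nth 0%N (0%N :: s).
have step u : (lag_count (nth 0%N s) (4 * e) (size s) d phi u <=
    lag_count a (4 * e) (size s).+1 d phi u <=
    lag_count (nth 0%N s) (4 * e) (size s) d phi u + 1)%N.
  rewrite /lag_count; have [ds|sd] := leqP d (size s); last first.
    have -> : ((size s).+1 - d = 0)%N by lia.
    have -> : (size s - d = 0)%N by lia.
    by rewrite !big_ord0.
  rewrite subSn // big_ord_recl.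
  rewrite [X in (_ <= _ + X <= _)%N](_ : _ =
    (\sum_(i < size s - d) phi (4 * e + nth 0 s (i + d) - nth 0 s i + u))%N); last first.
    exact: eq_bigr.
  by case: (phi _); lia.
have := sP d phi d0; have := step 0%N; have := step 1%N; rewrite sk.
move=> /andP[h1 h2] /andP[h3 h4] h5; nia.
Qed.

(** * Uniform frequencies of local events *)

Section Sums.
Variable R : realType.
Implicit Types T : nat -> R.

Lemma norm_sum_le T i j c : (forall k, (i <= k < j)%N -> `|T k| <= c) -> (i <= j)%N ->
  `|\sum_(i <= k < j) T k| <= (j - i)%:R * c.
Proof.
move=> Tc ij; apply: le_trans (ler_norm_sum _ _ _) _.
apply: le_trans (_ : \sum_(i <= k < j) c <= _).
  by rewrite big_nat_cond [leRHS]big_nat_cond; apply: ler_sum => k; rewrite andbT; exact: Tc.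
by rewrite sumr_const_nat mulr_natl.
Qed.

Lemma sum_nat_diff T i j : (i <= j)%N ->
  \sum_(i <= k < j) T k = \sum_(0 <= k < j) T k - \sum_(0 <= k < i) T k.
Proof. by move=> ij; rewrite [X in _ = X - _](@big_cat_nat _ _ _ i) //= [RHS]addrC addKr. Qed.

Lemma sum_nat_shift T i n : \sum_(i <= k < i + n) T k = \sum_(0 <= k < n) T (i + k)%N.
Proof.
by rewrite -{1}[i]addn0 addnC big_addn addKn; apply: eq_bigr => k _; rewrite addnC.
Qed.

End Sums.

Lemma cut_locate (Q : nat -> nat) j : (Q 0%N <= j)%N -> (forall m, (Q m < Q m.+1)%N) ->
  exists m, (Q m <= j < Q m.+1)%N.
Proof.
move=> Q0 Qlt; elim: j Q0 => [|j IH] Q0.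
  by exists 0%N; rewrite Q0; apply: leq_ltn_trans (Qlt 0%N).
have [Qj|jQ] := leqP (Q 0%N) j; last first.
  by exists 0%N; rewrite Q0; have := Qlt 0%N; lia.
have [m /andP[mj jm]] := IH Qj.
have [lt|ge] := ltnP j.+1 (Q m.+1); first by exists m; rewrite lt ltnW.
by exists m.+1; have := Qlt m.+1; lia.
Qed.

Section PartialSums.
Variables (R : realType) (T : nat -> R) (Q : nat -> nat) (len : nat) (eta : R).
Hypotheses (Q0 : Q 0%N = 0%N) (Qlt : forall m, (Q m < Q m.+1)%N).
Hypothesis (Qlen : forall m, (Q m.+1 <= Q m + len)%N).
Hypothesis T1 : forall k, `|T k| <= 1.
Hypothesis block : forall m,
  `|\sum_(Q m <= k < Q m.+1) T k| <= eta * (Q m.+1 - Q m)%:R.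

Lemma cut_mono m n : (m <= n)%N -> (Q m <= Q n)%N.
Proof.
move=> /subnK <-; elim: (n - m)%N => [|k IH]; first by [].
by rewrite addSn; apply: leq_trans IH (ltnW (Qlt _)).
Qed.

Lemma block_sums m n : (m <= n)%N ->
  `|\sum_(Q m <= k < Q n) T k| <= eta * (Q n - Q m)%:R.
Proof.
move=> mn; rewrite -(subnK mn); elim: (n - m)%N => [|k IH].
  by rewrite add0n subnn mulr0 big_geq // normr0.
rewrite addSn (@big_cat_nat _ _ _ (Q (k + m))) /=; last first.
- exact: ltnW.
- by apply: cut_mono; lia.
have e1 : (Q (k + m).+1 - Q m = (Q (k + m) - Q m) + (Q (k + m).+1 - Q (k + m)))%N.
  by have := Qlt (k + m); have : (Q m <= Q (k + m))%N; [apply: cut_mono; lia | lia].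
by rewrite e1 natrD mulrDr; apply: le_trans (ler_normD _ _) _; apply: lerD.
Qed.

(** Only the two blocks at the ends of the window are incomplete, and they
    contribute a constant. *)
Lemma window_sum i N : 0 <= eta ->
  `|\sum_(i <= k < i + N) T k| <= eta * N%:R + (2 + eta) * len%:R.
Proof.
move=> eta0.
have Q0le j : (Q 0%N <= j)%N by rewrite Q0.
have [m /andP[mi im]] := cut_locate Q i (Q0le i) Qlt.
have [n /andP[ni ine]] := cut_locate Q (i + N) (Q0le _) Qlt.
have mn : (m <= n)%N.
  rewrite leqNgt; apply/negP => nm.
  have := cut_mono _ _ nm; lia.
have e : \sum_(i <= k < i + N) T k =
    \sum_(Q m <= k < Q n) T k + \sum_(Q n <= k < i + N) T k - \sum_(Q m <= k < i) T k.
  rewrite (sum_nat_diff R T i (i + N)) ?leq_addr // (sum_nat_diff R T _ _ mi).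
  by rewrite (sum_nat_diff R T _ _ ni) (sum_nat_diff R T (Q m)) ?cut_mono //; ring.
rewrite e.
have b1 := block_sums _ _ mn.
have b2 : `|\sum_(Q n <= k < i + N) T k| <= len%:R.
  apply: le_trans (norm_sum_le _ _ _ _ 1 _ ni) _ => //.
  by rewrite mulr1 ler_nat; have := Qlen n; lia.
have b3 : `|\sum_(Q m <= k < i) T k| <= len%:R.
  apply: le_trans (norm_sum_le _ _ _ _ 1 _ mi) _ => //.
  by rewrite mulr1 ler_nat; have := Qlen m; lia.
have b4 : eta * (Q n - Q m)%:R <= eta * (N%:R + len%:R).
  by rewrite ler_wpM2l // -natrD ler_nat; have := Qlen m; lia.
apply: le_trans (ler_normB _ _) _.
apply: le_trans (lerD (ler_normD _ _) b3) _.
by lra.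
Qed.
End PartialSums.

Section Frequency.
Variable R : realType.
Implicit Types (F G : nat -> bool) (g : R).

(** The averages converge to [g] uniformly over the starting point of the
    window. *)
Definition uniform_frequency F g := forall eps : R, 0 < eps ->
  exists N0, forall N i, (N0 <= N)%N ->
    `|\sum_(i <= k < i + N) (F k)%:R - N%:R * g| <= eps * N%:R.

Lemma absorb_constant (eps C : R) : 0 < eps ->
  exists N0 : nat, forall N, (N0 <= N)%N -> C <= eps * N%:R.
Proof.
move=> eps0; exists (Num.Def.trunc (`|C| / eps)%R).+1 => N hN.
rewrite mulrC -ler_pdivrMr //.
apply: le_trans (_ : `|C| / eps <= _).
  by rewrite ler_wpM2r ?invr_ge0 ?(ltW eps0) // ler_norm.
apply: ltW; apply: lt_le_trans (truncnS_gt _) _; by rewrite ler_nat.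
Qed.

(** The frequency is the supremum of the lower densities [v] such that
    [N * v] stays below the number of occurrences up to a constant. *)
Lemma uniform_frequency_exists F :
  (forall eps : R, 0 < eps -> exists b C : R, forall i N,
     `|\sum_(i <= k < i + N) ((F k)%:R - b)| <= eps * N%:R + C) ->
  exists g, uniform_frequency F g.
Proof.
move=> H.
have sumB i N (b : R) : \sum_(i <= k < i + N) ((F k)%:R - b) =
    \sum_(i <= k < i + N) (F k)%:R - N%:R * b.
  by rewrite big_split /= sumr_const_nat addKn mulNrn mulr_natl.
pose A : set R := fun v => exists C : R, forall N : nat,
   N%:R * v <= \sum_(0 <= k < N) (F k)%:R + C.
have inA eps b C : (forall i N,
     `|\sum_(i <= k < i + N) ((F k)%:R - b)| <= eps * N%:R + C) -> A (b - eps).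
  move=> h; exists C => N; have := h 0%N N; rewrite sumB add0n ler_norml => /andP[h1 _].
  by rewrite mulrBr; lra.
have ubA eps b C v : 0 < eps -> (forall i N,
     `|\sum_(i <= k < i + N) ((F k)%:R - b)| <= eps * N%:R + C) -> A v -> v <= b + eps.
  move=> eps0 h [D hD]; rewrite leNgt; apply/negP => lt.
  have v0 : 0 < v - (b + eps) by rewrite subr_gt0.
  have [N0 hN] := absorb_constant _ (C + D + 1) v0.
  have := hN N0 (leqnn _); have := hD N0; have := h 0%N N0.
  rewrite sumB add0n ler_norml => /andP[_ h2].
  rewrite mulrBl mulrDl; lra.
exists (sup A) => eps eps0.
have e3 : 0 < eps / 4 by lra.
have [b [C h]] := H _ e3.
have hs : has_sup A.
  split; first by exists (b - eps / 4); exact: inA h.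
  by exists (b + eps / 4) => v; exact: ubA h.
have lo : b - eps / 4 <= sup A by apply: ub_le_sup; [exact: hs.2 | exact: inA h].
have hi : sup A <= b + eps / 4.
  by apply: sup_le_ub; [exact: hs.1 | move=> v; exact: ubA h].
have [N0 hN] := absorb_constant (eps / 4) C e3.
exists N0 => N i NN; have := h i N; have := hN N NN; rewrite sumB.
set S := \sum_(_ <= _ < _) _ => c1 c2.
have -> : S - N%:R * sup A = (S - N%:R * b) + N%:R * (b - sup A) by ring.
apply: le_trans (ler_normD _ _) _.
have : `|N%:R * (b - sup A)| <= N%:R * (eps / 4).
  by rewrite normrM ger0_norm // ler_wpM2l // ler_norml; apply/andP; split; lra.
have : 0 <= eps * N%:R by rewrite mulr_ge0 // ltW.
lra.
Qed.

Lemma uniform_frequency_ge0_le1 F g : uniform_frequency F g -> 0 <= g <= 1.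
Proof.
move=> H.
have S0 N : 0 <= \sum_(0 <= k < N) ((F k)%:R : R) by apply: sumr_ge0.
have S1 N : \sum_(0 <= k < N) ((F k)%:R : R) <= N%:R.
  rewrite -[leRHS](_ : \sum_(0 <= k < N) (1 : R) = _); last by rewrite sumr_const_nat subn0.
  by apply: ler_sum => k _; case: (F k).
have key eps : 0 < eps -> - eps <= g <= 1 + eps.
  move=> e0; have [N0 h] := H _ e0.
  have := h N0.+1 0%N (leqnSn _); rewrite add0n ler_norml => /andP[h1 h2].
  have := S0 N0.+1; have := S1 N0.+1.
  have Np : 0 < N0.+1%:R :> R by rewrite ltr0n.
  move: h1 h2; set N := N0.+1%:R; set S := \sum_(_ <= _ < _) _ => h1 h2 h3 h4.
  apply/andP; split; rewrite -(ler_pM2l Np); lra.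
apply/andP; split.
  by apply/ler_addgt0Pr => e e0; have /andP[] := key e e0; lra.
by apply/ler_addgt0Pr => e e0; have /andP[] := key e e0; lra.
Qed.

End Frequency.

Definition local_at (x : nat -> bool) l (F : nat -> bool) :=
  forall i j, (forall k, (k < l)%N -> x (i + k)%N = x (j + k)%N) -> F i = F j.

Section CoreFrequency.
Variables (R : realType) (x : nat -> bool) (Q : nat -> nat) (h s l : nat) (F : nat -> bool).
Hypotheses (Q0 : Q 0%N = 0%N) (h_gt0 : (0 < h)%N).
Hypothesis Qgap : forall m, (Q m + h <= Q m.+1 <= Q m + h + s)%N.
Hypothesis Qcore : forall m p, (p < h)%N -> x (Q m + p)%N = x p.
Hypothesis Floc : local_at x l F.

Let b : R := (\sum_(0 <= p < h) (F p)%:R) / h%:R.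

(** A block starts with a copy of the first [h] letters of [x], and [F] sees
    only [l] letters, so at most [l] of the first [h] values of [F] in the block
    differ from the initial ones; at most [s] letters remain. *)
Lemma block_frequency m :
  `|\sum_(Q m <= k < Q m.+1) ((F k)%:R - b)| <= (l + s)%:R / h%:R * (Q m.+1 - Q m)%:R.
Proof.
have hp : 0 < h%:R :> R by rewrite ltr0n.
have b01 : 0 <= b <= 1.
  rewrite /b divr_ge0 ?sumr_ge0 //= ler_pdivrMr // mul1r.
  rewrite -[leRHS](_ : \sum_(0 <= k < h) (1 : R) = _); last by rewrite sumr_const_nat subn0.
  by apply: ler_sum => k _; case: (F k).
have /andP[g1 g2] := Qgap m.
apply: le_trans (_ : (l + s)%:R <= _); last first.
  rewrite -mulrA ler_peMr // mulrC ler_pdivlMr // mul1r ler_nat; lia.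
rewrite (@big_cat_nat _ _ _ (Q m + h)) ?leq_addr //= sum_nat_shift.
rewrite natrD; apply: le_trans (ler_normD _ _) _; apply: lerD; last first.
  apply: le_trans (norm_sum_le _ _ _ _ 1 _ g1) _; last by rewrite mulr1 ler_nat; lia.
  move=> k _; case/andP: b01 => b0 b1; case: (F k) => /=; rewrite ler_norml; apply/andP; split; lra.
have -> : \sum_(0 <= k < h) ((F (Q m + k)%N)%:R - b) =
    \sum_(0 <= k < h) ((F (Q m + k)%N)%:R - (F k)%:R).
  rewrite !big_split /= !sumrN sumr_const_nat subn0 /b; congr (_ - _).
  by rewrite -[LHS]mulr_natl mulrC divfK // gt_eqF.
have zero k : (k + l <= h)%N -> (F (Q m + k)%N)%:R - (F k)%:R = 0 :> R.
  move=> kl; rewrite (Floc (Q m + k)%N k) ?subrr // => j jl.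
  by rewrite -addnA Qcore //; lia.
rewrite (@big_cat_nat _ _ _ (h - l)) ?leq_subr //= big_nat_cond big1 ?add0r; last first.
  by move=> k; rewrite andbT => kk; apply: zero; lia.
apply: le_trans (norm_sum_le _ _ _ _ 1 _ (leq_subr _ _)) _; last by rewrite mulr1 ler_nat; lia.
by move=> k _; case: (F _); case: (F k); rewrite ?subrr ?subr0 ?sub0r ?normrN ?normr0 ?normr1.
Qed.

Lemma window_frequency i N :
  `|\sum_(i <= k < i + N) ((F k)%:R - b)| <=
    (l + s)%:R / h%:R * N%:R + (2 + (l + s)%:R / h%:R) * (h + s)%:R.
Proof.
have hp : 0 < h%:R :> R by rewrite ltr0n.
apply: (@window_sum R _ Q) => //.
- by move=> m; have := Qgap m; lia.
- by move=> m; have := Qgap m; lia.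
- move=> k.
  have b0 : 0 <= b by rewrite /b divr_ge0 ?sumr_ge0.
  have b1 : b <= 1.
    rewrite /b ler_pdivrMr // mul1r.
    rewrite -[leRHS](_ : \sum_(0 <= k < h) (1 : R) = _); last by rewrite sumr_const_nat subn0.
    by apply: ler_sum => j _; case: (F j).
  by case: (F k) => /=; rewrite ler_norml; apply/andP; split; lra.
- exact: block_frequency.
Qed.
End CoreFrequency.

(** * Correlations at the scale of one level *)

Lemma lag_count_setC a M n d (phi : nat -> bool) u :
  (lag_count a M n d phi u + lag_count a M n d (fun v => ~~ phi v) u = n - d)%N.
Proof.
rewrite /lag_count -big_split /= -[RHS]card_ord -sum1_card.
by apply: eq_bigr => i _; case: (phi _).
Qed.

Section Averaging.
Variables (R : realType) (G : nat -> bool) (g eps : R) (J : nat).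
Hypothesis J_gt0 : (0 < J)%N.
Hypothesis GJ : forall i, `|\sum_(i <= k < i + J) (G k)%:R - J%:R * g| <= eps * J%:R.

(** If the sum of [G] along [sigma] changes by at most [eta] when [sigma] is
    moved by one, it is close to its average over [J] consecutive moves; and that
    average is, for each [i], an average of [G] over a window of length [J]. *)
Lemma average_shifts n (sigma : nat -> nat) (eta : R) : 0 <= eta -> 
  (forall u, `|\sum_(i < n) (G (sigma i + u)%N)%:R -
               \sum_(i < n) (G (sigma i + u.+1)%N)%:R| <= eta) ->
  `|\sum_(i < n) ((G (sigma i))%:R - g)| <= J%:R * eta + eps * n%:R.
Proof.
move=> eta0 Hs; set S := fun u => \sum_(i < n) ((G (sigma i + u)%N)%:R : R).
have Jp : 0 < J%:R :> R by rewrite ltr0n.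
have SE : \sum_(i < n) ((G (sigma i))%:R - g) = S 0%N - n%:R * g.
  rewrite big_split /= sumr_const card_ord mulNrn mulr_natl; congr (_ - _).
  by apply: eq_bigr => i _; rewrite addn0.
(* moving u times costs u times eta *)
have Su u : `|S 0%N - S u| <= u%:R * eta.
  elim: u => [|u IH]; first by rewrite subrr normr0 mul0r.
  have -> : S 0%N - S u.+1 = (S 0%N - S u) + (S u - S u.+1) by ring.
  rewrite -[u.+1%:R]natr1 mulrDl mul1r; apply: le_trans (ler_normD _ _) _.
  by apply: lerD => //; exact: Hs.
have avg : `|\sum_(u < J) S u - J%:R * (n%:R * g)| <= eps * J%:R * n%:R.
  rewrite /S exchange_big /=.
  have -> : J%:R * (n%:R * g) = \sum_(i < n) (J%:R * g).
    by rewrite sumr_const card_ord -[RHS]mulr_natl; ring.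
  rewrite -sumrB; apply: le_trans (ler_norm_sum _ _ _) _.
  apply: le_trans (_ : \sum_(i < n) eps * J%:R <= _); last first.
    by rewrite sumr_const card_ord -[leLHS]mulr_natl mulrC.
  apply: ler_sum => i _; have := GJ (sigma i).
  by rewrite (sum_nat_shift R (fun k => (G k)%:R)) big_mkord.
have sumS : `|\sum_(u < J) (S 0%N - S u)| <= J%:R * (J%:R * eta).
  apply: le_trans (ler_norm_sum _ _ _) _.
  apply: le_trans (_ : \sum_(u < J) J%:R * eta <= _); last first.
    by rewrite sumr_const card_ord -[leLHS]mulr_natl.
  apply: ler_sum => u _; apply: le_trans (Su u) _.
  by rewrite ler_wpM2r // ler_nat ltnW.
have e : J%:R * (S 0%N - n%:R * g) =
    \sum_(u < J) (S 0%N - S u) + (\sum_(u < J) S u - J%:R * (n%:R * g)).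
  by rewrite big_split /= sumrN sumr_const card_ord -[S 0%N *+ J]mulr_natl; ring.
rewrite SE -(ler_pM2l Jp) -[J%:R in X in X <= _]normr_nat -normrM e.
apply: le_trans (ler_normD _ _) _.
have -> : J%:R * (J%:R * eta + eps * n%:R) = J%:R * (J%:R * eta) + eps * J%:R * n%:R by ring.
exact: lerD.
Qed.

Variables (e M r : nat) (a : nat -> nat).
Hypothesis e_gt0 : (0 < e)%N.
Hypothesis a_le : forall i, (a i <= M)%N.
Hypothesis spread : spread_word e M r a.

Lemma spread_counts d phi : (0 < d)%N ->
  `|(lag_count a M r d phi 0)%:R - (lag_count a M r d phi 1)%:R| <= 2 * r%:R / e%:R :> R.
Proof.
move=> d0; have ep : 0 < e%:R :> R by rewrite ltr0n.
have := spread d phi d0; have := spread d (fun v => ~~ phi v) d0.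
have := lag_count_setC a M r d phi 0; have := lag_count_setC a M r d phi 1.
set A0 := lag_count _ _ _ _ phi 0; set A1 := lag_count _ _ _ _ phi 1.
set B0 := lag_count _ _ _ _ _ 0; set B1 := lag_count _ _ _ _ _ 1 => h1 h0 hB hA.
have c1 : (e * A0 <= e * A1 + 2 * r)%N by [].
have c2 : (e * A1 <= e * A0 + 2 * r)%N.
  have : (A1 + B1 = A0 + B0)%N by rewrite h1 h0.
  nia.
rewrite ler_norml ler_pdivlMr // -mulNr ler_pdivrMr // ; apply/andP.
have := c1; have := c2; rewrite -!(ler_nat R) !natrD !natrM => *; split; lra.
Qed.

Lemma spread_average_forward s d : (0 < d)%N -> (M <= s)%N ->
  `|\sum_(i < r - d) ((G (s + a (i + d) - a i)%N)%:R - g)| <=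
    (J%:R * 2 / e%:R) * r%:R + `|eps| * r%:R.
Proof.
move=> d0 Ms.
have ep : 0 < e%:R :> R by rewrite ltr0n.
apply: le_trans (average_shifts (r - d) (fun i => s + a (i + d) - a i)%N (2 * r%:R / e%:R) _ _) _.
- by rewrite divr_ge0 ?mulr_ge0.
- move=> u; have := spread_counts d (fun v => G (s - M + v + u)%N) d0.
  rewrite /lag_count !natr_sum; congr (`|_ - _| <= _); apply: eq_bigr => i _;
    congr (G _)%:R; have := a_le i; have := a_le (i + d); lia.
apply: lerD; first by rewrite [leLHS](_ : _ = J%:R * 2 / e%:R * r%:R) //; ring.
apply: le_trans (_ : `|eps| * (r - d)%:R <= _).
  by rewrite ler_wpM2r // ler_norm.
by rewrite ler_wpM2l // ler_nat leq_subr.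
Qed.

Lemma spread_average_backward s d : (0 < d)%N -> (M <= s)%N ->
  `|\sum_(i < r - d) ((G (s + a i - a (i + d))%N)%:R - g)| <=
    (J%:R * 2 / e%:R) * r%:R + `|eps| * r%:R.
Proof.
move=> d0 Ms.
have ep : 0 < e%:R :> R by rewrite ltr0n.
apply: le_trans (average_shifts (r - d) (fun i => s + a i - a (i + d))%N (2 * r%:R / e%:R) _ _) _.
- by rewrite divr_ge0 ?mulr_ge0.
- move=> u; have := spread_counts d (fun v => G (s + M + u.+1 - v)%N) d0.
  rewrite /lag_count !natr_sum distrC; congr (`|_ - _| <= _); apply: eq_bigr => i _;
    congr (G _)%:R; have := a_le i; have := a_le (i + d); lia.
apply: lerD; first by rewrite [leLHS](_ : _ = J%:R * 2 / e%:R * r%:R) //; ring.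
apply: le_trans (_ : `|eps| * (r - d)%:R <= _).
  by rewrite ler_wpM2r // ler_norm.
by rewrite ler_wpM2l // ler_nat leq_subr.
Qed.
End Averaging.

Lemma count_small n c : (\sum_(p < n) (p < c)%N <= c)%N.
Proof.
elim: n => [|n IH]; first by rewrite big_ord0.
have [nc|cn] := ltnP n c; last by rewrite big_ord_recr /= ltnNge cn addn0.
apply: leq_trans nc; rewrite -[X in (_ <= X)%N]card_ord -sum1_card.
by apply: leq_sum => p _; case: (_ < _)%N.
Qed.

Lemma count_large n c : (\sum_(p < n) (n < p + c)%N <= c)%N.
Proof.
rewrite (reindex_inj rev_ord_inj) /=; apply: leq_trans (count_small n c).
by apply: leq_sum => p _; have := ltn_ord p; case: ltnP => //; case: ltnP => //; lia.
Qed.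

Lemma sum_residues D t (phi : nat -> nat) : (0 < D)%N ->
  (\sum_(p < D) phi ((p + t) %% D)%N = \sum_(p < D) phi p)%N.
Proof.
case: D => // D _; elim: t => [|t <-].
  by apply: eq_bigr => p _; rewrite addn0 modn_small.
rewrite big_ord_recr big_ord_recl /= add0n -addSnnS modnDl addnC; congr (_ + _)%N.
by apply: eq_bigr => p _; rewrite addnS.
Qed.

Lemma count_residues D n t (phi : nat -> bool) : (n <= D)%N -> (0 < D)%N ->
  (\sum_(p < n) phi ((p + t) %% D)%N <= \sum_(p < D) phi p)%N.
Proof.
move=> nD D0; rewrite -(sum_residues D t (fun p => phi p : nat) D0).
rewrite -!(big_mkord xpredT (fun p => phi ((p + t) %% D)%N : nat)).
by rewrite [X in (_ <= X)%N](@big_cat_nat _ _ _ n) //= leq_addr.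
Qed.

(** A block of length [len] carries [r] equidistant columns with pitch [D].
    Column [i] moved by [z] falls at column [i + k] of the same block when
    [i < r - k], and at column [i - d] of the next block when [i >= d]; the
    offsets are [s] and [s'].  Fewer than [B] columns escape both cases. *)
Lemma lag_indices D r S B h z len : (0 < D)%N ->
  (D <= z)%N -> (z < r * D + h)%N -> (r * D + h <= len)%N -> (len <= r * D + S)%N ->
  (S + 2 * D <= B * D)%N ->
  exists k d s s', [/\ (z = k * D + s)%N, (d * D + z = len + s')%N,
    (z %% D = s)%N, ((z + (D - 1) * len) %% D = s')%N &
    [/\ (0 < k)%N, (0 < d)%N, (r - k <= d)%N & (d + k < r + B)%N]].
Proof.
move=> D0 Dz zr len1 len2 SB.
have k1 : (0 < z %/ D)%N by rewrite divn_gt0.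
have zE := divn_eq z D; have sD := ltn_pmod z D0.
(* y is the distance left to the next block, rounded up to d columns *)
have [y yE] : exists y, (y + z = len)%N by exists (len - z)%N; lia.
have y0 : (0 < y)%N by lia.
have [d d1 d2] : exists2 d, (y <= d * D)%N & (d * D < y + D)%N.
  exists ((y + D - 1) %/ D)%N; have := divn_eq (y + D - 1) D;
    have := ltn_pmod (y + D - 1) D0; set q := (_ %/ _)%N; set m := (_ %% _)%N;
    clearbody q m; clear -y0 D0; lia.
have [s' s'E] : exists s', (s' + y = d * D)%N by exists (d * D - y)%N; lia.
exists (z %/ D)%N, d, (z %% D)%N, s'; move: k1 zE sD.
move: (z %/ D)%N (z %% D)%N => k s k1 zE sD.
have dlen : (d <= len)%N.
  rewrite -(leq_pmul2r D0); have := leq_pmulr len D0.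
  have -> : (len * D = (len - 1) * D + D)%N by rewrite mulnBl mul1n subnK // leq_pmull //; lia.
  have : (len - 1 <= (len - 1) * D)%N by apply: leq_pmulr.
  clear -d2 yE Dz D0 y0; lia.
split=> //; first by clear -s'E yE; lia.
  have -> : (z + (D - 1) * len = (len - d) * D + s')%N.
    have := leq_mul dlen (leqnn D); have := leq_pmull len D0.
    rewrite !mulnBl mul1n [(D * len)%N]mulnC; clear -s'E yE; lia.
  by rewrite modnMDl modn_small //; clear -s'E d2; lia.
split=> //.
- by case: d y0 {d2 s'E dlen} d1 => //; rewrite mul0n; clear; lia.
- have : (r * D < (d + k + 1) * D)%N by rewrite !mulnDl mul1n; clear -d1 zE sD yE len1; lia.
  by rewrite ltn_pmul2r //; clear; lia.
- have : ((d + k) * D < (r + B) * D)%N by rewrite !mulnDl; clear -d2 zE yE len2 SB D0; lia.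
  by rewrite ltn_pmul2r.
Qed.

Section OneLevel.
Variables (R : realType) (x : nat -> bool) (Q : nat -> nat) (a : nat -> nat).
Variables (h D M r S B e l J : nat) (G : nat -> bool) (g eps : R).
Hypotheses (e_gt0 : (0 < e)%N) (J_gt0 : (0 < J)%N) (h_gt0 : (0 < h)%N).
Hypothesis GJ : forall i, `|\sum_(i <= k < i + J) (G k)%:R - J%:R * g| <= eps * J%:R.
Hypothesis g01 : 0 <= g <= 1.
Hypotheses (a_le : forall i, (a i <= M)%N) (a_first : a 0%N = 0%N) (a_last : a r = 0%N).
Hypothesis spread : spread_word e M r a.
Hypothesis hD : (h + M <= D)%N.
Hypothesis Qgap : forall m, (Q m + (r * D + h) <= Q m.+1 <= Q m + (r * D + S))%N.
Hypothesis Qcore : forall m i p, (i < r)%N -> (p < h)%N ->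
  x (Q m + (i * D + a i + p))%N = x p.
Hypothesis Gloc : local_at x l G.
Hypothesis SB : (S + 2 * D <= B * D)%N.

(** Offsets that stay in the core, together with the window of length [l]
    behind them, under all displacements. *)
Definition inner s := (M <= s)%N && (s + M + l <= h)%N.
Definition column_error : R := 2 * (J%:R * 2 / e%:R + `|eps|) * r%:R + B%:R.

Let D_gt0 : (0 < D)%N. Proof. by lia. Qed.

Lemma discrepancy_le1 j : `|(G j)%:R - g| <= 1.
Proof. by case/andP: g01 => *; case: (G j) => /=; rewrite ler_norml; apply/andP; split; lra. Qed.

(** The main estimate.  By [lag_indices] the columns split into those
    that land in the same block, those that land in the next block, and a few
    others.  In the first two cases [G] is read in a copy of the initial core at
    an offset plus a difference of displacements at a fixed positive lag, and
    spreading turns the sum over columns into averages over windows. *)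
Lemma column_sum m z :
  (D <= z)%N -> (z < r * D + h)%N -> inner (z %% D)%N ->
  inner ((z + (D - 1) * (Q m.+1 - Q m)) %% D)%N ->
  `|\sum_(i < r) ((G (Q m + (i * D + a i) + z)%N)%:R - g)| <= column_error.
Proof.
set len := (Q m.+1 - Q m)%N => Dz zr.
have /andP[g1 g2] := Qgap m.
have lenE : Q m.+1 = (Q m + len)%N by rewrite /len; lia.
have len1 : (r * D + h <= len)%N by lia.
have len2 : (len <= r * D + S)%N by lia.
clearbody len.
have [k [d [s [s' [zE dE -> -> [k1 d1 n1d dkB]]]]]] :=
  lag_indices _ _ _ _ _ _ _ D_gt0 Dz zr len1 len2 SB.
move=> /andP[Ms sh] /andP[Ms' s'h].
pose n2 := minn d r.
have n2r : (n2 <= r)%N by apply: geq_minr.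
have n12 : (r - k <= n2)%N by rewrite leq_min n1d leq_subr.
have n2B : (n2 - (r - k) <= B)%N.
  by have := geq_minl d r; rewrite -/n2; clear -dkB n2r; lia.
pose T i : R := (G (Q m + (i * D + a i) + z)%N)%:R - g.
rewrite -(big_mkord xpredT T) (@big_cat_nat _ _ _ n2) //=.
rewrite (@big_cat_nat _ _ _ (r - k)) //=.
have b1 : `|\sum_(0 <= i < r - k) T i| <= (J%:R * 2 / e%:R) * r%:R + `|eps| * r%:R.
  have := spread_average_backward R G g eps J J_gt0 GJ e M r a e_gt0 a_le spread s k k1 Ms.
  rewrite big_mkord; congr (`|_| <= _); apply: eq_bigr => i _; rewrite /T.
  congr ((nat_of_bool _)%:R - _); apply: Gloc => j jl; have ir := ltn_ord i.
  have -> : (Q m + (i * D + a i) + z + j =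
      Q m + ((i + k) * D + a (i + k) + (s + a i - a (i + k) + j)))%N.
    by rewrite zE mulnDl; have := a_le (i + k); clear -Ms; lia.
  by rewrite Qcore //; have := a_le i; clear -ir jl sh; lia.
have b3 : `|\sum_(n2 <= i < r) T i| <= (J%:R * 2 / e%:R) * r%:R + `|eps| * r%:R.
  have [rd|dr] := leqP r d.
    rewrite /n2 (minn_idPr rd) big_geq // normr0.
    by rewrite addr_ge0 // mulr_ge0 // divr_ge0 ?mulr_ge0.
  rewrite /n2 (minn_idPl (ltnW dr)) -[in X in `|X|](subnKC (ltnW dr)) sum_nat_shift big_mkord.
  have := spread_average_forward R G g eps J J_gt0 GJ e M r a e_gt0 a_le spread s' d d1 Ms'.
  congr (`|_| <= _); apply: eq_bigr => i _; rewrite /T.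
  congr ((nat_of_bool _)%:R - _); apply: Gloc => j jl; have ir := ltn_ord i.
  have -> : (Q m + ((d + i) * D + a (d + i)) + z + j =
      Q m.+1 + (i * D + a i + (s' + a (i + d) - a i + j)))%N.
    by rewrite lenE mulnDl [(d + i)%N]addnC; have := a_le i; clear -dE Ms'; lia.
  by rewrite Qcore //; have := a_le (i + d); clear -ir jl s'h; lia.
have b2 : `|\sum_(r - k <= i < n2) T i| <= B%:R.
  apply: le_trans (norm_sum_le _ _ _ _ 1 _ n12) _; first by move=> j _; exact: discrepancy_le1.
  by rewrite mulr1 ler_nat.
apply: le_trans (ler_normD _ _) _.
apply: le_trans (lerD (ler_normD _ _) b3) _.
rewrite /column_error; move: b1 b2; set u := _ / _; set v := `|eps|; lra.
Qed.

Variables (lF : nat) (F : nat -> bool).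
Hypothesis Floc : local_at x lF F.

(** A bound on the number of positions [p] of a core for which [column_sum]
    does not apply to [z = p + t]. *)
Definition stray : nat := (lF + (D - h) + 2 * (D - h + 2 * M + l))%N.

Lemma count_not_inner : (\sum_(s < D) ~~ inner s <= D - h + 2 * M + l)%N.
Proof.
apply: leq_trans (_ : (\sum_(s < D) ((s < M)%N + (D < s + (D - h + M + l)))%N) <= _)%N.
  apply: leq_sum => s _; rewrite /inner negb_and -ltnNge -ltnNge.
  by case: ltnP => //= _; case: ltnP => //= hs; case: ltnP => //; lia.
rewrite big_split /=; apply: leq_trans (leq_add (count_small D M) (count_large D _)) _.
by clear; lia.
Qed.

(** The block is summed column by column: in a core, [F] depends on the position
    [p] only, so for each [p] it factors out of the sum over the columns, to
    which [column_sum] applies. *)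
Lemma block_correlation t m : (h <= t)%N -> (t < r * D)%N ->
  `|\sum_(Q m <= j < Q m.+1) (F j)%:R * ((G (j + t)%N)%:R - g)| <=
  h%:R * column_error + (r * (stray + (D - h)) + S)%:R.
Proof.
move=> ht tr.
pose T j : R := (F j)%:R * ((G (j + t)%N)%:R - g).
have T1 j : `|T j| <= 1.
  by rewrite /T normrM normr_nat; case: (F j); rewrite ?mul1r ?mul0r ?discrepancy_le1.
have /andP[g1 g2] := Qgap m.
have core_part n : (n <= r)%N ->
   `|\sum_(Q m <= j < Q m + (n * D + a n)) T j -
     \sum_(i < n) \sum_(p < h) T (Q m + (i * D + a i) + p)%N| <= (n * (D - h) + a n)%:R.
  elim: n => [|n IH] nr.
    by rewrite mul0n add0n a_first addn0 big_geq // big_ord0 subrr normr0.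
  have := a_le n; have := a_le n.+1 => an1 an.
  rewrite big_ord_recr /= (@big_cat_nat _ _ _ (Q m + (n * D + a n))) /=; [|lia|nia].
  rewrite (@big_cat_nat _ _ _ (Q m + (n * D + a n) + h) (Q m + (n * D + a n))) /=; [|lia|nia].
  rewrite (sum_nat_shift R T (Q m + (n * D + a n)) h) big_mkord.
  set A := \sum_(_ <= _ < _) _; set A' := \sum_(i < h) _; set A'' := \sum_(_ <= _ < _) _.
  set C := \sum_(i < n) _ in IH *.
  have -> : A + (A' + A'') - (C + A') = (A - C) + A'' by ring.
  have -> : (n.+1 * (D - h) + a n.+1 = (n * (D - h) + a n) + (D - h + a n.+1 - a n))%N.
    by rewrite mulSn; lia.
  rewrite natrD; apply: le_trans (ler_normD _ _) _; apply: lerD; first by apply: IH; lia.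
  apply: le_trans (norm_sum_le _ _ _ _ 1 _ _) _ => //; first by nia.
  by rewrite mulr1 ler_nat mulSn; lia.
have := core_part r (leqnn r); rewrite a_last !addn0 => {}core_part.
rewrite (@big_cat_nat _ _ _ (Q m + r * D)) /=; [|lia|lia].
have tail : `|\sum_(Q m + r * D <= j < Q m.+1) T j| <= S%:R.
  apply: le_trans (norm_sum_le _ _ _ _ 1 _ _) _ => //; first by lia.
  by rewrite mulr1 ler_nat; lia.
pose len := (Q m.+1 - Q m)%N.
(* counts the failures among: F reads inside the core; p + t >= D, given t >= h; the two offsets are inner *)
pose bad p : nat := ((h < p + lF) + (p < D - h) + ~~ inner ((p + t) %% D) +
  ~~ inner ((p + (t + (D - 1) * len)) %% D))%N.
have col p : (p < h)%N -> `|\sum_(i < r) T (Q m + (i * D + a i) + p)%N| <=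
    column_error + (r * bad p)%:R.
  move=> ph; have [b0|bpos] := posnP (bad p); last first.
    apply: le_trans (_ : r%:R <= _); last first.
      apply: le_trans (_ : (r * bad p)%:R <= _); first by rewrite ler_nat leq_pmulr.
      by rewrite lerDr /column_error addr_ge0 ?mulr_ge0 ?addr_ge0 ?divr_ge0 ?mulr_ge0.
    apply: le_trans (ler_norm_sum _ _ _) _.
    apply: le_trans (_ : \sum_(i < r) 1 <= _); last by rewrite sumr_const card_ord.
    by apply: ler_sum => i _; apply: T1.
  rewrite b0 muln0 addr0.
  move: b0; rewrite /bad => b0.
  have h1 : (p + lF <= h)%N by move: b0; case: ltnP.
  have h2 : (D <= p + t)%N by move: b0; case: (ltnP p (D - h)) => //; lia.
  have h3 : inner ((p + t) %% D)%N by move: b0; case: (inner ((p + t) %% D)%N) => //; lia.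
  have h4 : inner ((p + t + (D - 1) * len) %% D)%N.
    by rewrite -addnA; move: b0; case: (inner ((p + (t + (D - 1) * len)) %% D)%N) => //; lia.
  have := column_sum m (p + t) h2 _ h3 h4; set X := (X in `|X|) => cs.
  have -> : \sum_(i < r) T (Q m + (i * D + a i) + p)%N = (F p)%:R * X.
    rewrite mulr_sumr; apply: eq_bigr => i _.
    have -> : (Q m + (i * D + a i) + (p + t) = Q m + (i * D + a i) + p + t)%N by rewrite addnA.
    rewrite /T; congr ((nat_of_bool _)%:R * _).
    apply: Floc => j jl.
    have -> : (Q m + (i * D + a i) + p + j = Q m + (i * D + a i + (p + j)))%N by rewrite !addnA.
    by rewrite Qcore //; clear -jl h1; lia.
  rewrite normrM normr_nat; case: (F p); rewrite ?mul1r ?mul0r; first by apply: cs; lia.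
  by rewrite /column_error addr_ge0 ?mulr_ge0 ?addr_ge0 ?divr_ge0 ?mulr_ge0.
have bads : (\sum_(p < h) bad p <= stray)%N.
  rewrite /bad !big_split /= /stray.
  have hh : (h <= D)%N by lia.
  have c := count_not_inner.
  have c1 := leq_trans (count_residues D h t (fun s => ~~ inner s) hh D_gt0) c.
  have c2 := leq_trans (count_residues D h (t + (D - 1) * len) (fun s => ~~ inner s) hh D_gt0) c.
  have c0 := leq_add (count_large h lF) (count_small h (D - h)).
  by apply: leq_trans (leq_add (leq_add c0 c1) c2) _; clear; lia.
have main : `|\sum_(i < r) \sum_(p < h) T (Q m + (i * D + a i) + p)%N| <=
    h%:R * column_error + (r * stray)%:R.
  rewrite exchange_big /=; apply: le_trans (ler_norm_sum _ _ _) _.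
  apply: le_trans (_ : \sum_(p < h) (column_error + (r * bad p)%:R) <= _).
    by apply: ler_sum => p _; apply: col.
  rewrite big_split /= sumr_const card_ord -[column_error *+ h]mulr_natl lerD2l.
  by rewrite -natr_sum -big_distrr /= ler_nat leq_mul2l bads orbT.
rewrite mulnDr !natrD; set A := \sum_(_ <= _ < _) _ in core_part *.
move: core_part main tail; set C := \sum_(i < r) _ => c1 c2 c3.
have -> : A = (A - C) + C by ring.
apply: le_trans (ler_normD _ _) _; apply: le_trans (lerD (ler_normD _ _) c3) _.
lra.
Qed.

End OneLevel.

(** * Choice of the parameters *)

Section TowerFrequencies.
Variables (R : realType) (e r : nat -> nat) (a : nat -> nat -> nat).
Let M n := (4 * e n)%N.
Hypothesis e_gt0 : forall n, (0 < e n)%N.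
Hypothesis a_le : forall n i, (a n i <= M n)%N.
Hypothesis a_first : forall n, a n 0%N = 0%N.
Hypothesis a_last : forall n, a n (r n) = 0%N.
Hypothesis r_gt1 : forall n, (1 < r n)%N.
Hypothesis spread : forall n, spread_word (e n) (M n) (r n) (a n).
Hypothesis e_infty : forall k, exists n0, forall n, (n0 <= n)%N -> (k <= e n)%N.
Hypothesis r_large : forall n, (2 * (e n * M n.+1) <= r n)%N.

Let M_gt2 n : (2 < M n)%N. Proof. by rewrite /M; have := e_gt0 n; lia. Qed.

Let core n := core M r n.
Let pad n := pad M r n.
Let pitch n := pitch M r n.
Let x := limit_word M r a.
Let Q n := cut M r a n.

Let coreS n : core n.+1 = (r n * pitch n)%N. Proof. by []. Qed.
Let padS n : pad n.+1 = (2 * M n.+1 * (core n + pad n))%N. Proof. by []. Qed.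
Let pitchE n : pitch n = (core n + pad n + M n)%N. Proof. by []. Qed.

Let core_gt n : (n < core n)%N.
Proof. exact: (core_gt M r r_gt1). Qed.

(** Everything that has to be negligible is so by a factor [e], since
    [r n >= 2 * e n * M n.+1] makes the length tuning short and [M] small. *)
Lemma negligible_scales k : exists n0, forall n, (n0 <= n)%N ->
  [/\ (k <= e n)%N, (k <= core n)%N, (k * pad n <= core n)%N, (k * M n <= core n)%N &
      (k * M n.+1 <= r n)%N].
Proof.
have [n0 he] := e_infty k; exists (n0 + k).+1 => n n0n.
have e1 := he n ltac:(lia).
split=> //; first by have := core_gt n; lia.
- case: n n0n {e1} => // n n0n; rewrite coreS padS pitchE.
  have := r_large n; have := he n ltac:(lia); move: (core n) (pad n) => c p e2 rl.
  have h1 : (k * (2 * M n.+1) <= r n)%N by nia.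
  have : (k * (2 * M n.+1) * (c + p) <= r n * (c + p))%N by rewrite leq_mul2r h1 orbT.
  rewrite mulnDr; lia.
- case: n n0n {e1} => // n n0n; rewrite coreS pitchE.
  have := r_large n; have := he n ltac:(lia); have := core_gt n.
  move: (core n) (pad n) => c p c0 e2 rl.
  have : (k * M n.+1 <= r n)%N by nia.
  have : (r n * 1 <= r n * (c + p + M n))%N by rewrite leq_mul2l; lia.
  lia.
- have := r_large n; nia.
Qed.

Let cut_gap n m : (Q n m + core n <= Q n m.+1 <= Q n m + core n + (pad n + 2 * M n))%N.
Proof.
rewrite /Q cutS; have := type_at_is_type M r a a_le a_first M_gt2 r_gt1 n m.
by rewrite /is_type /core /pad; lia.
Qed.

Let cut0 n : Q n 0%N = 0%N. Proof. by rewrite /Q /cut big_ord0. Qed.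

Let x_cut n m p : (p < core n)%N -> x (Q n m + p)%N = x p.
Proof. exact: (limit_word_cut_core M r a a_le a_first a_last M_gt2 r_gt1). Qed.

Let x_subcut n m i p : (i < r n)%N -> (p < core n)%N ->
  x (Q n.+1 m + (i * pitch n + a n i + p))%N = x p.
Proof. exact: (limit_word_cut_subcore M r a a_le a_first a_last M_gt2 r_gt1). Qed.

Lemma tower_uniform_frequency l F : local_at x l F -> exists g : R, uniform_frequency R F g.
Proof.
move=> Floc; apply: uniform_frequency_exists => eps eps0.
have [k hk] := absorb_constant R eps 4 eps0.
have [n hn] := negligible_scales (k.+1 * l.+1).
have [_ h2 h3 h4 _] := hn n (leqnn _).
have core0 : (0 < core n)%N by have := core_gt n; lia.
exists ((\sum_(0 <= p < core n) (F p)%:R) / (core n)%:R).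
exists ((2 + (l + (pad n + 2 * M n))%:R / (core n)%:R) * (core n + (pad n + 2 * M n))%:R) => i N.
apply: le_trans (window_frequency R x (Q n) (core n) (pad n + 2 * M n) l F
  (cut0 n) core0 (cut_gap n) (x_cut n) Floc i N) _.
rewrite lerD2r ler_wpM2r // ler_pdivrMr ?ltr0n //.
rewrite -(ler_pM2l (_ : 0 < k.+1%:R :> R)) ?ltr0n //.
apply: le_trans (_ : 4 * (core n)%:R <= _).
  rewrite -!natrM ler_nat; move: (core n) (pad n) (M n) h2 h3 h4 => c p m h2 h3 h4.
  have : (k.+1 * l <= c)%N by nia.
  have : (k.+1 * p <= c)%N by nia.
  have : (k.+1 * m <= c)%N by nia.
  by rewrite !mulnDr; clear; nia.
rewrite mulrA ler_wpM2r // mulrC; apply: hk; lia.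
Qed.

(** For [t] between [core n] and [core n.+1], [block_correlation] is used on the
    blocks of level [n + 1]; the error is [eps / 2] from the averages over windows,
    plus a multiple of [1 / k] for a factor [k] as in [negligible_scales]. *)
Lemma tower_mixing lF F lG G (g eps : R) :
  local_at x lF F -> local_at x lG G -> uniform_frequency R G g -> 0 < eps ->
  exists t0, forall t, (t0 <= t)%N -> exists C : R, forall N,
    `|\sum_(0 <= k < N) (F k)%:R * ((G (k + t)%N)%:R - g)| <= eps * N%:R + C.
Proof.
move=> Floc Gloc Gg eps0.
have g01 := uniform_frequency_ge0_le1 R G g Gg.
have d0 : 0 < eps / 4 by lra.
have [N0 hJ] := Gg _ d0; pose J := N0.+1.
have GJ i : `|\sum_(i <= k < i + J) (G k)%:R - J%:R * g| <= eps / 4 * J%:R.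
  by apply: hJ; rewrite /J.
(* k.+1 times the relative error of block_correlation, apart from the term due to the windows of length J *)
pose C1 : nat := (4 * J + 24 + lF + 2 * lG)%N.
have [k hk] := absorb_constant R (eps / 2) C1%:R ltac:(lra).
have [n0 hn] := negligible_scales k.+1.
exists (core n0) => t tn0.
have core_lt n : (core n < core n.+1)%N.
  by rewrite coreS pitchE; have := r_gt1 n; have := core_gt n; nia.
have [||j /andP[jt tj]] := cut_locate (fun j => core (n0 + j)) t.
- by rewrite addn0.
- by move=> j; rewrite addnS.
move: jt tj; rewrite addnS; set n := (n0 + j)%N => nt tn.
have [h1 h2 h3 h4 h5] := hn n (leq_addr _ _).
have core0 : (0 < core n)%N by have := core_gt n; lia.
pose B := (4 * M n.+1 + 2)%N; pose S := (pad n.+1 + 2 * M n.+1)%N.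
have block m := @block_correlation R x (Q n.+1) (a n) (core n) (pitch n) (M n) (r n) S B
  (e n) lG J G g (eps / 4) (e_gt0 n) (ltn0Sn _) core0 GJ g01 (a_le n) (a_first n)
  (a_last n) (spread n) _ _ (x_subcut n) Gloc _ lF F Floc t m nt tn.
have M1 := M_gt2 n.+1.
have pe := pitchE n.
have gap m : (Q n.+1 m + (r n * pitch n + core n) <= Q n.+1 m.+1 <=
    Q n.+1 m + (r n * pitch n + S))%N.
  have := cut_gap n.+1 m; rewrite coreS /S padS => /andP[g1 g2].
  apply/andP; split; last by rewrite -addnA in g2.
  have := type_at_is_type M r a a_le a_first M_gt2 r_gt1 n.+1 m => _.
  rewrite /Q cutS -/(core _) -/(pad _) coreS padS; nia.
have SB : (S + 2 * pitch n <= B * pitch n)%N.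
  by rewrite /S /B padS pe; move: (core n) (pad n) (M n) (M n.+1) core0 => c p m m' c0; nia.
have hD : (core n + M n <= pitch n)%N by rewrite pe; lia.
have {}block := block hD gap SB.
have kp : 0 < k.+1%:R :> R by rewrite ltr0n.
have ep : 0 < (e n)%:R :> R by rewrite ltr0n.
have bound : (core n)%:R * column_error R (r n) B (e n) J (eps / 4) +
    (r n * (stray (core n) (pitch n) (M n) lG lF + (pitch n - core n)) + S)%:R <=
    eps * (r n * core n)%:R.
  have u1 : k.+1%:R * (J%:R * 2 / (e n)%:R) <= 2 * J%:R :> R.
    rewrite mulrA ler_pdivrMr // mulrC [2 * _]mulrC ler_wpM2l ?mulr_ge0 // ler_nat //.
  have u2 : (k.+1 * B <= 6 * r n)%N.
    apply: leq_trans (_ : 6 * (k.+1 * M n.+1) <= _)%N; last by rewrite leq_mul2l h5.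
    by rewrite mulnCA leq_mul2l /= /B; move: M1; clear; lia.
  have u3 : (k.+1 * (r n * (stray (core n) (pitch n) (M n) lG lF + (pitch n - core n)) + S)
      <= (lF + 2 * lG + 18) * (r n * core n))%N.
    have v1 : (k.+1 * (stray (core n) (pitch n) (M n) lG lF + (pitch n - core n)) <=
       (lF + 2 * lG + 12) * core n)%N.
      rewrite /stray pe; move: (core n) (pad n) (M n) h2 h3 h4 => c p m h2 h3 h4.
      have -> : (c + p + m - c = p + m)%N by clear; lia.
      have : (k.+1 * (lF + 2 * lG) <= c * (lF + 2 * lG))%N by rewrite leq_mul2r h2 orbT.
      by rewrite !mulnDr !mulnDl; move: h2 h3 h4; clear; lia.
    have v2 : (k.+1 * S <= 6 * (r n * core n))%N.
      rewrite /S padS.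
      have pc : (pad n <= core n)%N by apply: leq_trans h3; apply: leq_pmull.
      have : (2 * M n.+1 * (core n + pad n) + 2 * M n.+1 <= 6 * (M n.+1 * core n))%N.
        move: (core n) (pad n) (M n.+1) pc core0 => c p m pc c0.
        have := leq_pmulr m c0; have : (m * p <= m * c)%N by rewrite leq_mul2l pc orbT.
        by clear; lia.
      have : (k.+1 * M n.+1 * core n <= r n * core n)%N by rewrite leq_mul2r h5 orbT.
      move: (core n) (pad n) (M n.+1) => c p m w1 w2.
      apply: leq_trans (leq_mul (leqnn k.+1) w2) _.
      by move: w1; clear; lia.
    rewrite mulnDr mulnCA.
    have : (r n * (k.+1 * (stray (core n) (pitch n) (M n) lG lF + (pitch n - core n))) <=
       r n * ((lF + 2 * lG + 12) * core n))%N by rewrite leq_mul2l v1 orbT.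
    by move: v2; clear; lia.
  have u4 : C1%:R <= eps / 2 * k.+1%:R by apply: hk; lia.
  rewrite -(ler_pM2l kp) mulrDr -natrM.
  move: u3; rewrite -(ler_nat R) => u3.
  apply: le_trans (lerD (lexx _) u3) _.
  rewrite /column_error (ger0_norm (ltW d0)).
  have c0 : 0 <= (core n)%:R :> R by [].
  have r0 : 0 <= (r n)%:R :> R by [].
  move: u2; rewrite -(ler_nat R) !natrM => u2.
  set u := _ / _ in u1 *.
  have -> : k.+1%:R * ((core n)%:R * (2 * (u + eps / 4) * (r n)%:R + B%:R)) =
     (core n)%:R * (2 * (k.+1%:R * u + k.+1%:R * (eps / 4)) * (r n)%:R + k.+1%:R * B%:R).
    by ring.
  apply: le_trans (_ : (core n)%:R * (2 * (2 * J%:R + k.+1%:R * (eps / 4)) * (r n)%:R +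
    6 * (r n)%:R) + (lF + 2 * lG + 18)%:R * ((r n)%:R * (core n)%:R) <= _).
    rewrite lerD2r ler_wpM2l // lerD // ler_wpM2r // ler_wpM2l //.
    by rewrite lerD2r.
  have -> : (core n)%:R * (2 * (2 * J%:R + k.+1%:R * (eps / 4)) * (r n)%:R +
    6 * (r n)%:R) + (lF + 2 * lG + 18)%:R * ((r n)%:R * (core n)%:R) =
    (C1%:R + eps / 2 * k.+1%:R) * ((r n)%:R * (core n)%:R) :> R.
    by rewrite /C1 !natrD !natrM; field.
  rewrite [leRHS](_ : _ = (eps * k.+1%:R) * ((r n)%:R * (core n)%:R)); last first.
    by ring.
  apply: ler_wpM2r; first by rewrite mulr_ge0.
  by move: u4; lra.
pose T j : R := (F j)%:R * ((G (j + t)%N)%:R - g).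
exists ((2 + eps) * (r n * pitch n + S)%:R) => N.
have := @window_sum R T (Q n.+1) (r n * pitch n + S) eps (cut0 _) _ _ _ _ 0%N N (ltW eps0).
rewrite add0n; apply.
- by move=> m; have /andP[g1 _] := gap m; lia.
- by move=> m; have /andP[_ g2] := gap m.
- move=> i; rewrite /T normrM normr_nat; case/andP: g01 => g0 g1.
  by case: (F i); case: (G _) => /=; rewrite ?mul1r ?mul0r ?ler01 // ler_norml;
    apply/andP; split; lra.
- move=> m; apply: le_trans (block m) _; apply: le_trans bound _.
  rewrite ler_wpM2l ?(ltW eps0) // ler_nat.
  have /andP[g1 _] := gap m.
  have : (r n * core n <= r n * pitch n)%N by rewrite leq_mul2l pe; lia.
  by move: g1; clear; lia.
Qed.

(** Every word of level 1 starts with the letters [false], [true], so both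
    letters recur within bounded gaps. *)
Lemma tower_letter_frequency : exists2 g : R, uniform_frequency R x g & 0 < g < 1.
Proof.
have xloc : local_at x 1 x by move=> i j /(_ 0%N isT); rewrite !addn0.
have [g gx] := tower_uniform_frequency _ _ xloc; exists g => //.
have /andP[cg c1] : (2 <= core 1 <= core 1)%N.
  by rewrite leqnn coreS pitchE; have := r_gt1 0; have := core_gt 0; nia.
have x0 : x 0%N = false.
  by rewrite /x (limit_word_core M r a a_le a_first a_last M_gt2 r_gt1 0).
have x1 : x 1%N = true.
  have t0 : (0 < first_type M a 0)%N by rewrite /first_type; have := M_gt2 0; lia.
  rewrite /x (limit_wordE M r a a_le a_first a_last M_gt2 r_gt1 0) /= ?size_nseq //.
  by case: (first_type M a 0) t0.
pose len := (core 1 + (pad 1 + 2 * M 1))%N.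
have lenp : 0 < len%:R :> R by rewrite ltr0n /len; lia.
have Qlen m : (Q 1 m <= m * len)%N.
  elim: m => [|m IH]; first by rewrite cut0.
  by have /andP[_] := cut_gap 1 m; rewrite mulSn /len; lia.
have Qlt m : (m <= Q 1 m)%N.
  elim: m => [|m IH] //; have /andP[h _] := cut_gap 1 m; lia.
have count (c : bool) m : m%:R <= \sum_(0 <= k < Q 1 m) ((x k == c)%:R : R).
  elim: m => [|m IH]; first by rewrite cut0 big_geq.
  have /andP[h _] := cut_gap 1 m.
  rewrite (@big_cat_nat _ _ _ (Q 1 m)) //=; last by lia.
  rewrite -natr1; apply: lerD => //.
  have cp : ((c : nat) < core 1)%N by clear -cg; case: c; lia.
  have cq : (Q 1 m + c < Q 1 m.+1)%N by lia.
  rewrite (bigD1_seq (Q 1 m + c)%N) ?iota_uniq //=; last by rewrite mem_index_iota; lia.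
  rewrite x_cut // (_ : x c == c = true); last by clear -x0 x1; case: c; rewrite ?x0 ?x1.
  by rewrite lerDl sumr_ge0.
have eps0 : 0 < (2 * len%:R)^-1 :> R by rewrite invr_gt0 mulr_gt0.
have [N0 hN] := gx _ eps0.
pose m := N0.+1; pose N := Q 1 m.
have NN : (N0 <= N)%N by have := Qlt m; rewrite /N /m; lia.
have Np : 0 < N%:R :> R by rewrite ltr0n /N; have := Qlt m; rewrite /m; lia.
have := hN N 0%N NN; rewrite add0n ler_norml => /andP[h1 h2].
have mN : N%:R <= m%:R * len%:R :> R by rewrite -natrM ler_nat Qlen.
have cT := count true m; have cF := count false m.
have sF : \sum_(0 <= k < N) ((x k == false)%:R : R) = N%:R - \sum_(0 <= k < N) (x k)%:R.
  have -> : N%:R = \sum_(0 <= k < N) (1 : R) by rewrite sumr_const_nat subn0.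
  by rewrite -sumrB; apply: eq_bigr => k _; case: (x k); rewrite ?subrr ?subr0.
have sT : \sum_(0 <= k < N) ((x k == true)%:R : R) = \sum_(0 <= k < N) (x k)%:R.
  by apply: eq_bigr => k _; rewrite eqb_id.
move: cT cF; rewrite -/N sF sT => cT cF.
have e2 : (2 * len%:R)^-1 * N%:R < m%:R :> R.
  rewrite mulrC ltr_pdivrMr ?mulr_gt0 //; apply: le_lt_trans mN _.
  have : 0 < m%:R * len%:R :> R by rewrite mulr_gt0 // ltr0n.
  lra.
apply/andP; split; rewrite -(ltr_pM2l Np); lra.
Qed.

Local Arguments word : simpl never.

(** A subword of length [q <= core n.+1] is determined by the types of the two
    consecutive words of level [n + 1] that contain it and by its offset in the
    first. *)
Lemma tower_complexity n q : (core n <= q)%N -> (q <= core n.+1)%N ->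
  (M n <= core n)%N -> (pad n <= core n)%N ->
  exists W : seq (seq bool),
    (size W <= (2 * M n.+1 + 1) ^ 2 * (9 * (r n * q)))%N /\
    forall i, mkseq (fun k => x (i + k)%N) q \in W.
Proof.
move=> nq qn Mc pc; pose K := (2 * M n.+1 + 1)%N.
pose L := (core n.+1 + pad n.+1 + 2 * M n.+1)%N.
have K0 : forall m, (type_at M r a n.+1 m < K)%N.
  move=> m; have := type_at_is_type M r a a_le a_first M_gt2 r_gt1 n.+1 m.
  by rewrite /is_type /K; clear; lia.
exists [seq take q (drop p.2 (word M r a n.+1 p.1.1 ++ word M r a n.+1 p.1.2)) |
          p <- [seq (tt', j) | tt' <- [seq (t, t') | t <- iota 0 K, t' <- iota 0 K],
                               j <- iota 0 L]].
split.
  rewrite size_map !size_allpairs !size_iota -/K mulnn leq_mul2l; apply/orP; right.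
  have rl : (2 * M n.+1 <= r n)%N.
    by apply: leq_trans (r_large n); rewrite leq_mul2l /= leq_pmull.
  have w1 : (pad n.+1 <= core n.+1)%N.
    by rewrite padS coreS pitchE; apply: leq_mul => //; rewrite leq_addr.
  have w2 : (2 * M n.+1 <= core n.+1)%N.
    by apply: leq_trans rl _; rewrite coreS pitchE leq_pmulr //; have := core_gt n; lia.
  have w3 : (core n.+1 <= 3 * (r n * q))%N.
    by rewrite coreS mulnCA leq_mul2l; apply/orP; right; rewrite pitchE; move: nq Mc pc; clear; lia.
  by rewrite /L; move: w1 w2 w3; clear; lia.
move=> i.
have [||m /andP[mi im]] := cut_locate (Q n.+1) i.
- by rewrite cut0.
- by move=> m; have /andP[h _] := cut_gap n.+1 m; have := core_gt n.+1; lia.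
have [j jE] : exists j, (i = Q n.+1 m + j)%N by exists (i - Q n.+1 m)%N; lia.
pose t := type_at M r a n.+1 m; pose t' := type_at M r a n.+1 m.+1.
pose len := (core n.+1 + pad n.+1 + t)%N.
have jL : (j < len)%N.
  by move: im; rewrite jE /Q cutS -/(core _) -/(pad _) -/t /len; clear; lia.
have len_t : size (word M r a n.+1 t) = len.
  by rewrite size_word // /is_type; have := K0 m; rewrite /K -/t; clear; lia.
have len_t' : size (word M r a n.+1 t') = (core n.+1 + pad n.+1 + t')%N.
  by rewrite size_word // /is_type; have := K0 m.+1; rewrite /K -/t'; clear; lia.
apply/mapP; exists ((t, t'), j).
  apply: allpairs_f; first by apply: allpairs_f; rewrite mem_iota /= K0.
  by rewrite mem_iota /=; apply: leq_trans jL _; have := K0 m;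
    rewrite /len /L /K -/t; clear; lia.
have sz : (j + q <= size (word M r a n.+1 t ++ word M r a n.+1 t'))%N.
  by rewrite size_cat len_t len_t'; move: jL qn; clear; lia.
apply: (@eq_from_nth _ false); rewrite size_mkseq /=.
  by rewrite size_takel // size_drop; move: sz; clear; lia.
move=> k kq; rewrite nth_mkseq // nth_take // nth_drop nth_cat len_t jE.
case: ltnP => ok.
  by rewrite -addnA /x limit_word_cut.
have -> : (Q n.+1 m + j + k = Q n.+1 m.+1 + (j + k - len))%N.
  by rewrite /Q cutS -/(core _) -/(pad _) -/t -/len; move: ok; clear; lia.
by rewrite /x limit_word_cut //; move: jL qn kq ok; rewrite -/(core _) -/(pad _); clear; lia.
Qed.

End TowerFrequencies.

Definition superlinear (f : nat -> nat) :=
  forall k, exists q0, forall q, (q0 <= q)%N -> (k * q <= f q)%N.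

(** The complexity per letter at quality [e], from [tower_complexity] with
    [M = 4 * e] at the present level and at most [4 * e.+1] at the next one.  The
    leading factor [e] makes it negligible and not merely bounded. *)
Definition block_cost (r : nat -> nat) e : nat :=
  (e * ((2 * (4 * e.+1) + 1) ^ 2 * (9 * r e)))%N.

(** The quality is raised by one at level [n + 1] as soon as [f] affords it from
    [n + 1] on.  This is legitimate because [core n > n] whatever the
    parameters are.  Raising by one at a time keeps [M n.+1] small against
    [r n], which is fixed by the quality at level [n]. *)
Fixpoint quality (r f : nat -> nat) n : nat :=
  if n is m.+1 then
    if `[< forall q, (m < q)%N -> (block_cost r (quality r f m).+1 * q <= f q)%N >]
    then (quality r f m).+1 else quality r f m
  else 1%N.

Section Quality.
Variables (r f : nat -> nat).
Hypothesis f_superlinear : superlinear f.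
Let E := quality r f.

Lemma quality_gt0 n : (0 < E n)%N.
Proof. by elim: n => [|n IH] //; rewrite /E /=; case: ifP. Qed.

Lemma quality_step n : (E n <= E n.+1 <= (E n).+1)%N.
Proof. by rewrite /E /=; case: ifP => _; lia. Qed.

Lemma quality_mono m n : (m <= n)%N -> (E m <= E n)%N.
Proof.
move=> /subnK <-; elim: (n - m)%N => [|k IH] //.
by rewrite addSn; apply: leq_trans IH _; case/andP: (quality_step (k + m)).
Qed.

Lemma quality_cost n q : (1 < E n)%N -> (n <= q)%N -> (block_cost r (E n) * q <= f q)%N.
Proof.
elim: n => [|n IH] //; rewrite /E /= -/E; case: ifP => [/asboolP h|_] e1 nq; first exact: h.
by apply: IH => //; apply: ltnW.
Qed.

Lemma quality_infty k : exists n0, forall n, (n0 <= n)%N -> (k <= E n)%N.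
Proof.
elim: k => [|k [n0 IH]]; first by exists 0%N.
have [q0 hq] := f_superlinear (block_cost r k.+1).
pose n := maxn n0 q0; exists n.+1 => m nm; apply: leq_trans (quality_mono _ _ nm).
have := IH n (leq_maxl _ _); rewrite leq_eqVlt => /orP[/eqP kE|lt]; last first.
  by apply: leq_trans lt _; case/andP: (quality_step n).
rewrite /E /= -/E -kE; case: asboolP => // h; exfalso; apply: h => q nq.
by apply: hq; apply: leq_trans (leq_maxr n0 q0) (ltnW nq).
Qed.
End Quality.

(** The combinatorial core: an infinite word with uniform frequencies, whose
    correlations at distance [t] factorize as [t] grows, both of whose letters
    have positive frequency, and whose complexity is negligible against [f]. *)
Theorem mixing_word_exists (R : realType) (f : nat -> nat) : superlinear f ->
  exists x : nat -> bool, [/\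
    forall l F, local_at x l F -> exists g : R, uniform_frequency R F g,
    forall lF F lG G (g eps : R),
      local_at x lF F -> local_at x lG G -> uniform_frequency R G g -> 0 < eps ->
      exists t0, forall t, (t0 <= t)%N -> exists C : R, forall N,
        `|\sum_(0 <= k < N) (F k)%:R * ((G (k + t)%N)%:R - g)| <= eps * N%:R + C,
    exists2 g : R, uniform_frequency R x g & 0 < g < 1 &
    forall K, exists q0, forall q, (q0 <= q)%N -> exists W : seq (seq bool),
      (K * size W <= f q)%N /\ forall i, mkseq (fun k => x (i + k)%N) q \in W].
Proof.
move=> fsl.
have spreads e : exists ra : nat * (nat -> nat), (0 < e)%N ->
  [/\ (2 * (e * (4 * e.+1)) + 2 <= ra.1)%N, (forall i, (ra.2 i <= 4 * e)%N),
      ra.2 0%N = 0%N, ra.2 ra.1 = 0%N & spread_word e (4 * e) ra.1 ra.2].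
  have [->|e0] := posnP e; first by exists (0%N, id).
  have [r [a [h1 h2 h3 h4 h5]]] := exists_spread e (2 * (e * (4 * e.+1)) + 2) e0.
  by exists (r, a) => _; split.
have [ra raP] := choice spreads.
pose rr e := (ra e).1; pose e := quality rr f.
have e0 : forall n, (0 < e n)%N by apply: quality_gt0.
pose r n := rr (e n); pose a n := (ra (e n)).2.
have H n := raP (e n) (e0 n).
have r1 n : (1 < r n)%N by have [h _ _ _ _] := H n; rewrite /r /rr; lia.
have rl n : (2 * (e n * (4 * e n.+1)) <= r n)%N.
  have [h _ _ _ _] := H n; have /andP[_ h'] := quality_step rr f n.
  apply: leq_trans (_ : 2 * (e n * (4 * (e n).+1)) <= _)%N.
    by rewrite leq_mul2l leq_mul2l leq_mul2l h' !orbT.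
  by rewrite /r /rr; move: h; clear; lia.
have ale n i : (a n i <= 4 * e n)%N by have [_ h _ _ _] := H n; exact: h.
have af n : a n 0%N = 0%N by have [_ _ h _ _] := H n; exact: h.
have al n : a n (r n) = 0%N by have [_ _ _ h _] := H n; exact: h.
have sp n : spread_word (e n) (4 * e n) (r n) (a n) by have [_ _ _ _ h] := H n; exact: h.
have einf : forall k, exists n0, forall n, (n0 <= n)%N -> (k <= e n)%N.
  exact: (quality_infty rr f fsl).
exists (limit_word (fun n => 4 * e n)%N r a); split.
- exact: (tower_uniform_frequency R e r a).
- exact: (tower_mixing R e r a).
- exact: (tower_letter_frequency R e r a).
move=> K.
have [n0 hn] := negligible_scales e r r1 einf rl 1.
have [n1 hn1] := einf (K + 2)%N.
pose h := core (fun n => 4 * e n)%N r.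
have h_lt n : (h n < h n.+1)%N.
  rewrite /h coreS /pitch; have := r1 n; have := core_gt (fun n => 4 * e n)%N r r1 n.
  by move: (core _ _ n) (pad _ _ n) => c p; nia.
pose n2 := maxn n0 n1.
exists (h n2) => q nq.
have [||j /andP[jq qj]] := cut_locate (fun j => h (n2 + j)%N) q.
- by rewrite addn0.
- by move=> j; rewrite addnS.
move: jq qj; rewrite addnS; set n := (n2 + j)%N => jq qj.
have n0n : (n0 <= n)%N by rewrite /n /n2; move: (leq_maxl n0 n1); clear; lia.
have n1n : (n1 <= n)%N by rewrite /n /n2; move: (leq_maxr n0 n1); clear; lia.
have [_ _ pc Mc _] := hn n n0n; rewrite !mul1n in pc Mc.
have [W [sW hW]] := tower_complexity e r a e0 ale af al r1 rl n q jq (ltnW qj) Mc pc.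
exists W; split => //.
have Ke := hn1 n n1n.
have e2 : (1 < e n)%N by move: Ke; clear; lia.
have nq' : (n <= q)%N by apply: leq_trans jq; apply: ltnW; apply: core_gt.
apply: leq_trans (quality_cost rr f n q e2 nq').
have s12 : ((2 * (4 * e n.+1) + 1) ^ 2 <= (2 * (4 * (e n).+1) + 1) ^ 2)%N.
  rewrite leq_exp2r // leq_add2r leq_mul2l /= leq_mul2l /=.
  by have /andP[_ le] := quality_step rr f n.
rewrite /block_cost -/e; move: sW s12.
move: (_ ^ 2)%N (_ ^ 2)%N => s1 s2 sW s12; rewrite -!mulnA; apply: leq_mul.
  by move: Ke; clear; lia.
by apply: leq_trans sW _; apply: leq_mul.
Qed.

(** * Cylinders in the full shift *)

(** The enumeration 0, -1, 1, -2, 2, and so on of the coordinates, so that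
    cylinders are indexed by finite words and nested like a binary tree. *)
Definition coord (k : nat) : int := if odd k then Negz k./2 else Posz k./2.
Definition coord_index (z : int) : nat :=
  match z with Posz n => n.*2 | Negz n => n.*2.+1 end.

Lemma coord_indexK z : coord (coord_index z) = z.
Proof. by case: z => n; rewrite /coord /= odd_double /= ?uphalf_double ?doubleK. Qed.

Lemma coord_indexE k : coord_index (coord k) = k.
Proof.
rewrite /coord; case: ifP => ok /=; have := odd_double_half k; rewrite ok; lia.
Qed.

Local Notation config := (full_shift bool).

Definition cylinder (s : seq bool) : set config :=
  [set y : config | forall i, (i < size s)%N -> y (coord i) = nth false s i].

Definition prefix_word (y : config) n : seq bool := mkseq (fun i => y (coord i) : bool) n.

Lemma cylinder_prefix y n : cylinder (prefix_word y n) y.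
Proof. by move=> i; rewrite size_mkseq => lt; rewrite nth_mkseq. Qed.

Lemma cylinder_rcons s b :
  cylinder (rcons s b) = cylinder s `&` [set y : config | y (coord (size s)) = b].
Proof.
apply/seteqP; split => y.
  move=> h; split.
    by move=> i lt; have := h i; rewrite size_rcons nth_rcons lt ltnS (ltnW lt) => ->.
  by have := h (size s); rewrite size_rcons nth_rcons ltnn eqxx ltnSn; apply.
move=> [h1 h2] i; rewrite size_rcons ltnS leq_eqVlt nth_rcons => /orP[/eqP ->|lt].
  by rewrite ltnn eqxx.
by rewrite lt h1.
Qed.

Lemma cylinder_nil : cylinder [::] = setT.
Proof. by apply/seteqP; split. Qed.

(** The sets containing a cylinder around [y] form a filter that converges to
    [y] in each coordinate, hence in the product topology. *)
Lemma cylinder_basis (U : set config) y : open U -> U y ->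
  exists n, cylinder (prefix_word y n) `<=` U.
Proof.
move=> oU Uy.
pose F : set_system config := [set V | exists n, cylinder (prefix_word y n) `<=` V].
have mono m n : (m <= n)%N -> cylinder (prefix_word y n) `<=` cylinder (prefix_word y m).
  move=> mn z h i; rewrite size_mkseq => im.
  have := h i; rewrite size_mkseq => -> //; last by apply: leq_trans mn.
  by rewrite !nth_mkseq //; apply: leq_trans mn.
have FF : Filter F.
  split.
  - by exists 0%N.
  - move=> A B [m hA] [n hB]; exists (maxn m n) => z hz; split.
      by apply: hA; apply: mono hz; apply: leq_maxl.
    by apply: hB; apply: mono hz; apply: leq_maxr.
  - by move=> A B AB [n hA]; exists n; apply: subset_trans AB.
suff : F --> y by apply; apply: open_nbhs_nbhs; split.
apply/cvg_sup => i; apply/cvg_image.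
  by apply/seteqP; split => // b _; exists (fun=> b).
move=> B; rewrite nbhs_principalE => By.
have By' : B (y i) by exact: By.
exists [set z : config | B (z i)]; last first.
  by apply/seteqP; split => [b [z Bz <-]//|b Bb]; exists (fun=> b).
exists (coord_index i).+1 => z hz.
have e : y i = z i.
  have := hz (coord_index i); rewrite size_mkseq coord_indexK nth_mkseq // coord_indexK.
  by move=> ->.
exact: (eq_ind _ (fun b => B b) By' _ e).
Qed.

Local Notation Omega := (borel_shift bool).

Definition cylinders : set (set Omega) := [set B | B = set0 \/ exists s, B = cylinder s].

Lemma open_coordinate z b : open [set y : config | y z = b].
Proof.
have : open ((fun y : config => y z) @^-1` [set b : discrete_topology bool]).
  apply: open_comp; last exact: discrete_open.
  by move=> y _; exact: (@proj_continuous int (fun=> discrete_topology bool) z y).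
by [].
Qed.

Lemma measurable_open (U : set config) : open U -> measurable (U : set Omega).
Proof. by move=> oU; apply: sub_sigma_algebra. Qed.

Lemma measurable_coordinate z b : measurable ([set y | y z = b] : set Omega).
Proof. exact: measurable_open (open_coordinate z b). Qed.

Lemma measurable_cylinder s : measurable (cylinder s : set Omega).
Proof.
elim/last_ind: s => [|s b IH]; first by rewrite cylinder_nil; exact: measurableT.
by rewrite cylinder_rcons; apply: measurableI => //; exact: measurable_coordinate.
Qed.

Lemma open_bigcup_cylinders (U : set config) : open U ->
  U = \bigcup_(s in [set s | cylinder s `<=` U]) cylinder s.
Proof.
move=> oU; apply/seteqP; split => [y Uy|y [s sU] /sU //].
by have [n nU] := cylinder_basis U y oU Uy; exists (prefix_word y n) => //; exact: cylinder_prefix.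
Qed.

Lemma measurable_cylindersE : @measurable _ Omega = <<s cylinders >>.
Proof.
apply/seteqP; split; last first.
  apply: smallest_sub; first exact: sigma_algebra_measurable.
  by move=> _ [->|[s ->]]; [exact: measurable0 | exact: measurable_cylinder].
apply: smallest_sub; first exact: smallest_sigma_algebra.
move=> U oU; rewrite (open_bigcup_cylinders U oU) bigcup_mkcond.
apply: (@countable_bigcupT_measurable _ (g_sigma_algebraType cylinders)) => [|s].
  exact: countableP.
case: ifP => _; last exact: measurable0.
by apply: sub_sigma_algebra; right; exists s.
Qed.

Lemma cylinder_nested s t : (size s <= size t)%N ->
  cylinder s `&` cylinder t = set0 \/ cylinder s `&` cylinder t = cylinder t.
Proof.
move=> st; have [[y [ys yt]]|] := pselect (exists y, (cylinder s `&` cylinder t) y).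
  right; apply/seteqP; split => [z []//|z zt]; split=> // i lt.
  rewrite zt; last by apply: leq_trans st.
  by rewrite -ys // yt //; apply: leq_trans st.
by move=> h; left; apply/seteqP; split => // y hy; case: h; exists y.
Qed.

(** Cylinders are nested or disjoint; the empty set was included in
    [cylinders] for this purpose. *)
Lemma setI_closed_cylinders : setI_closed cylinders.
Proof.
move=> A B [->|[s ->]]; first by move=> _; left; rewrite set0I.
case=> [->|[t ->]]; first by left; rewrite setI0.
have [st|/ltnW ts] := leqP (size s) (size t).
  by have [->|->] := cylinder_nested s t st; [left|right; exists t].
by rewrite setIC; have [->|->] := cylinder_nested t s ts; [left|right; exists s].
Qed.

(** * A probability measure with prescribed values on cylinders *)

Section TreeMeasure.
Variables (R : realType) (g : seq bool -> R).

(** The intervals [[left_end s, left_end s + g s)], for [s] of a given length,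
    tile [[0, 1)] in lexicographic order. *)
Definition left_end (s : seq bool) : R :=
  \sum_(i < size s) if nth false s i then g (rcons (take i s) false) else 0.

(** The word of length [n] whose interval contains [u]. *)
Fixpoint branch (u : R) n : seq bool :=
  if n is m.+1 then
    rcons (branch u m) (left_end (branch u m) + g (rcons (branch u m) false) <= u)
  else [::].

Definition branch_config (u : R) : full_shift bool :=
  fun z => nth false (branch u (coord_index z).+1) (coord_index z).

Lemma left_end_rcons s b :
  left_end (rcons s b) = left_end s + if b then g (rcons s false) else 0.
Proof.
rewrite /left_end size_rcons big_ord_recr /= nth_rcons ltnn eqxx -cats1 take_size_cat //.
congr (_ + _); apply: eq_bigr => i _.
by rewrite nth_cat ltn_ord takel_cat // ltnW.
Qed.

Lemma size_branch u n : size (branch u n) = n.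
Proof. by elim: n => //= n IH; rewrite size_rcons IH. Qed.

Lemma nth_branch u i n : (i < n)%N -> nth false (branch u n) i = nth false (branch u i.+1) i.
Proof.
elim: n => // n IH; rewrite ltnS leq_eqVlt => /orP[/eqP <- //|lt].
by rewrite -IH //= nth_rcons size_branch lt.
Qed.

Lemma branch_configP u s : cylinder s (branch_config u) <-> branch u (size s) = s.
Proof.
split=> [h|<-].
  apply: (@eq_from_nth _ false); rewrite ?size_branch // => i lt.
  by rewrite nth_branch // -h // /branch_config coord_indexE.
by move=> i; rewrite size_branch => lt; rewrite /branch_config coord_indexE nth_branch.
Qed.

Lemma branch_rconsE u s b : branch u (size (rcons s b)) = rcons s b <->
  branch u (size s) = s /\ (left_end s + g (rcons s false) <= u) = b.
Proof.
rewrite size_rcons /=; split=> [/rcons_inj[-> <-]|[-> ->]] //; split => //.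
Qed.

Lemma measurable_branch s : measurable [set u : R | branch u (size s) = s].
Proof.
elim/last_ind: s => [|s b IH].
  by rewrite [X in measurable X](_ : _ = setT) //; apply/seteqP; split.
rewrite [X in measurable X](_ : _ = [set u | branch u (size s) = s] `&`
    [set u | (left_end s + g (rcons s false) <= u) = b]).
  apply: measurableI => //; set c := _ + _.
  case: b.
    rewrite (_ : [set u | _] = `[c, +oo[%classic); first exact: measurable_itv.
    by apply/seteqP; split => u /=; rewrite in_itv /= andbT.
  rewrite (_ : [set u | _] = `]-oo, c[%classic); first exact: measurable_itv.
  by apply/seteqP; split => u /=; rewrite in_itv /= ltNge; [move=> ->|move/negbTE].
by apply/seteqP; split => u /= /branch_rconsE.
Qed.

Lemma measurable_branch_config :
  measurable_fun setT (branch_config : measurableTypeR R -> borel_shift bool).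
Proof.
apply: (@measurability _ _ _ (borel_shift bool) setT _ cylinders).
  exact: measurable_cylindersE.
move=> _ [_ [->|[s ->]] <-]; rewrite setTI ?preimage_set0 //.
rewrite [X in measurable X](_ : _ = [set u : R | branch u (size s) = s]).
  exact: measurable_branch.
by apply/seteqP; split => u /= /branch_configP.
Qed.

Hypothesis g_ge0 : forall s, 0 <= g s.
Hypothesis g_nil : g [::] = 1.
Hypothesis g_split : forall s, g s = g (rcons s false) + g (rcons s true).

(** Splitting the interval of [s] at [left_end s + g (rcons s false)] decides
    the next letter of the branch. *)
Lemma branch_interval u s : 0 <= u < 1 ->
  branch u (size s) = s <-> left_end s <= u < left_end s + g s.
Proof.
move=> u01; elim/last_ind: s => [|s b IH].
  by rewrite /left_end big_ord0 g_nil add0r.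
rewrite branch_rconsE IH left_end_rcons.
have := g_split s; have := g_ge0 (rcons s false); have := g_ge0 (rcons s true).
case: b => /=; rewrite ?addr0; clear IH;
  move: (g (rcons s false)) (g (rcons s true)) (left_end s) => x y c x0 y0 ->; split.
- by move=> [/andP[h1 h2] h3]; rewrite h3; move: h2; rewrite addrA.
- move=> /andP[h1 h2]; rewrite h1; split => //; apply/andP; split; lra.
- by move=> [/andP[h1 h2] /negbT]; rewrite -ltNge => h3; apply/andP; split.
- move=> /andP[h1 h2]; split; first by apply/andP; split => //; lra.
  by apply/negbTE; rewrite -ltNge.
Qed.

Let m01 : measurable (`[0%R, 1%R[%classic : set (measurableTypeR R)). Proof. exact: measurable_itv. Qed.

Let interval_measure : {measure set (measurableTypeR R) -> \bar R} := mrestr (@lebesgue_measure R) m01.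

Let pushed : {measure set (borel_shift bool) -> \bar R} :=
  @measure_function_pushforward__canonical__measure_function_Measure _ _ _ _ R
    interval_measure (branch_config : measurableTypeR R -> borel_shift bool) measurable_branch_config.

Definition tree_measure (B : set (borel_shift bool)) : \bar R :=
  mrestr (@lebesgue_measure R) m01 ((branch_config : measurableTypeR R -> borel_shift bool) @^-1` B).

Let tree0 : tree_measure set0 = 0%E. Proof. exact: (measure0 pushed). Qed.
Let tree_ge0 B : (0 <= tree_measure B)%E. Proof. exact: (measure_ge0 pushed). Qed.
Let tree_sigma_additive : semi_sigma_additive tree_measure.
Proof. exact: (@measure_semi_sigma_additive _ _ _ pushed). Qed.

HB.instance Definition _ := isMeasure.Build _ _ _ tree_measure
  tree0 tree_ge0 tree_sigma_additive.

Lemma tree_measure_cylinder s : tree_measure (cylinder s) = (g s)%:E.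
Proof.
rewrite /tree_measure /mrestr.
rewrite (_ : _ `&` _ = `[left_end s, left_end s + g s[%classic).
  rewrite lebesgue_measure_itv /= lte_fin ltrDl -EFinB addrAC subrr add0r.
  by case: ltP => // h; congr EFin; apply/eqP; rewrite eq_le g_ge0 h.
have ends t : 0 <= left_end t /\ left_end t + g t <= 1.
  elim/last_ind: t => [|t b [IH1 IH2]].
    by rewrite /left_end big_ord0 g_nil add0r.
  rewrite left_end_rcons.
  have := g_split t; have := g_ge0 (rcons t false); have := g_ge0 (rcons t true).
  by case: b => /= h1 h2 h3; split; lra.
have [h0 h1] := ends s.
apply/seteqP; split => [u /= [/branch_configP h]|u /=]; rewrite !in_itv /=.
  by move=> u01; apply/branch_interval.
move=> /andP[h2 h3].
have u01 : 0 <= u < 1 by apply/andP; split; lra.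
by split=> //; apply/branch_configP/branch_interval; rewrite // h2 h3.
Qed.

Let tree_setT : tree_measure setT = 1%E.
Proof. by rewrite -cylinder_nil tree_measure_cylinder g_nil. Qed.

HB.instance Definition _ := Measure_isProbability.Build _ _ _ tree_measure tree_setT.

(** Every consistent assignment of masses to the nodes of the binary tree is
    realized, by pushing Lebesgue measure on [[0, 1)] along [branch_config]. *)
Lemma tree_measure_exists : exists P : probability (borel_shift bool) R,
  forall s, P (cylinder s) = (g s)%:E.
Proof. by exists tree_measure => s; exact: tree_measure_cylinder. Qed.
End TreeMeasure.

(** * Densities along the orbit of a word *)

Section Density.
Variable R : realType.
Implicit Types (T U : nat -> R) (g : R).

(** The averages from the origin converge to [g].  The constant absorbs any
    perturbation with bounded partial sums, in particular translations. *)
Definition density T g := forall eps, 0 < eps ->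
  exists C, forall N, `|\sum_(0 <= k < N) T k - N%:R * g| <= eps * N%:R + C.

Lemma density_unique T g g' : density T g -> density T g' -> g = g'.
Proof.
move=> h h'; apply/eqP; rewrite -subr_eq0 -normr_eq0 eq_le normr_ge0 andbT.
apply/ler_addgt0Pr => e e0; rewrite add0r leNgt; apply/negP => lt.
have e4 : 0 < e / 4 by lra.
have [C hC] := h _ e4; have [C' hC'] := h' _ e4.
have [N0 hN] := absorb_constant R (e / 4) (C + C') e4.
have := hC N0.+1; have := hC' N0.+1; have := hN N0.+1 (leqnSn _).
set N := N0.+1%:R; have Np : 0 < N by rewrite ltr0n.
set S := \sum_(_ <= _ < _) _ => h1 h2 h3.
have : N * `|g - g'| <= e * N.
  rewrite -[N in X in X <= _](ger0_norm (ltW Np)) -normrM.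
  have -> : N * (g - g') = (S - N * g') - (S - N * g) by ring.
  apply: le_trans (ler_normB _ _) _.
  have : 0 <= e * N by rewrite mulr_ge0 ?ltW.
  lra.
by rewrite mulrC ler_pM2r // leNgt lt.
Qed.

Lemma densityD T U g g' : density T g -> density U g' ->
  density (fun k => T k + U k) (g + g').
Proof.
move=> h h' e e0; have e2 : 0 < e / 2 by lra.
have [C hC] := h _ e2; have [C' hC'] := h' _ e2; exists (C + C') => N.
rewrite big_split /=; have := hC N; have := hC' N.
set S := \sum_(_ <= _ < _) T _; set S' := \sum_(_ <= _ < _) U _ => h1 h2.
have -> : S + S' - N%:R * (g + g') = (S - N%:R * g) + (S' - N%:R * g') by ring.
apply: le_trans (ler_normD _ _) _; lra.
Qed.

Lemma eq_density T U g : T =1 U -> density T g -> density U g.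
Proof.
move=> TU h e /h [C hC]; exists C => N; have := hC N.
by under eq_bigr do rewrite TU.
Qed.

Lemma density_perturb T U g B :
  (forall N, `|\sum_(0 <= k < N) T k - \sum_(0 <= k < N) U k| <= B) ->
  density T g -> density U g.
Proof.
move=> hB h e /h [C hC]; exists (C + B) => N.
have := hC N; have := hB N.
set S := \sum_(_ <= _ < _) T _; set S' := \sum_(_ <= _ < _) U _ => h1 h2.
have -> : S' - N%:R * g = (S - N%:R * g) - (S - S') by ring.
apply: le_trans (ler_normB _ _) _; lra.
Qed.

Lemma density_shift T n g : (forall k, `|T k| <= 1) ->
  density (fun k => T (k + n)%N) g <-> density T g.
Proof.
move=> T1.
have key N : `|\sum_(0 <= k < N) T (k + n)%N - \sum_(0 <= k < N) T k| <= (n + n)%:R.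
  have -> : \sum_(0 <= k < N) T (k + n)%N = \sum_(n <= k < n + N) T k.
    by rewrite sum_nat_shift; apply: eq_bigr => k _; rewrite addnC.
  rewrite sum_nat_diff ?leq_addr //.
  have -> : \sum_(0 <= k < n + N) T k = \sum_(0 <= k < N) T k + \sum_(N <= k < n + N) T k.
    by rewrite (@big_cat_nat _ _ _ N) //= leq_addl.
  set A := \sum_(0 <= k < N) _; set B := \sum_(N <= k < _) _; set C := \sum_(0 <= k < n) _.
  have -> : A + B - C - A = B - C by ring.
  apply: le_trans (ler_normB _ _) _; rewrite natrD; apply: lerD.
    apply: le_trans (norm_sum_le _ _ _ _ 1 _ (leq_addl _ _)) _ => //.
    by rewrite mulr1 addnK.
  apply: le_trans (norm_sum_le _ _ _ _ 1 _ (leq0n _)) _ => //.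
  by rewrite mulr1 subn0.
split; apply: (density_perturb _ _ _ (n + n)%:R) => N //.
by rewrite distrC.
Qed.

Lemma density_cst c : density (fun=> c) c.
Proof.
move=> e e0; exists 0 => N.
by rewrite sumr_const_nat subn0 mulr_natl subrr normr0 addr0 mulr_ge0 // ltW.
Qed.

Lemma density_eventually0 T n : (forall k, (n <= k)%N -> T k = 0) ->
  (forall k, `|T k| <= 1) -> density T 0.
Proof.
move=> T0 T1; apply/(density_shift _ n) => //.
by apply: eq_density (density_cst 0) => k; rewrite T0 // leq_addl.
Qed.

Lemma uniform_frequency_density (F : nat -> bool) g :
  uniform_frequency R F g -> density (fun k => (F k)%:R) g.
Proof.
move=> h e e0; have [N0 hN] := h e e0; exists (N0%:R * (1 + `|g|)) => N.
have [NN|lt] := leqP N0 N.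
  have := hN N 0%N NN; rewrite add0n => /le_trans; apply.
  by rewrite lerDl mulr_ge0 ?addr_ge0.
apply: le_trans (_ : N%:R * (1 + `|g|) <= _).
  rewrite mulrDr; apply: le_trans (ler_normB _ _) _; apply: lerD.
    apply: le_trans (norm_sum_le _ _ _ _ 1 _ (leq0n _)) _; last by rewrite subn0.
    by move=> k _; case: (F k); rewrite ?normr0 ?normr1.
  by rewrite normrM normr_nat.
apply: le_trans (_ : N0%:R * (1 + `|g|) <= _); last by rewrite lerDr mulr_ge0 // ltW.
by rewrite ler_wpM2r ?addr_ge0 // ler_nat ltnW.
Qed.

Lemma density_ge0 T g : (forall k, 0 <= T k) -> density T g -> 0 <= g.
Proof.
move=> T0 h; apply/ler_addgt0Pr => e e0; rewrite leNgt; apply/negP => lt.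
have e2 : 0 < - (g + e / 2) by lra.
have e3 : 0 < e / 2 by lra.
have [C hC] := h _ e3.
have [N0 hN] := absorb_constant R (- (g + e / 2)) (C + 1) e2.
have := hC N0; have := hN N0 (leqnn _); rewrite ler_norml => h1 /andP[_ h2].
have S0 : 0 <= \sum_(0 <= k < N0) T k by apply: sumr_ge0.
lra.
Qed.

End Density.

Section DensityBound.
Variable R : realType.
Implicit Types (T : nat -> R) (g : R).

Lemma density_scale T c g : density R T g -> density R (fun k => c * T k) (c * g).
Proof.
move=> h e e0; have c0 : 0 < `|c| + 1 by rewrite ltr_wpDl.
have ec : 0 < e / (`|c| + 1) by rewrite divr_gt0.
have [C hC] := h _ ec; exists (`|c| * C) => N.
rewrite -mulr_sumr; have := hC N; set S := \sum_(_ <= _ < _) _ => h1.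
have -> : c * S - N%:R * (c * g) = c * (S - N%:R * g) by ring.
rewrite normrM; apply: le_trans (ler_wpM2l (normr_ge0 c) h1) _.
rewrite mulrDr lerD2r mulrA ler_wpM2r // mulrCA ler_piMr ?(ltW e0) //.
by rewrite ler_pdivrMr // mul1r lerDl.
Qed.

Lemma density_bound T g eps C : 0 <= eps ->
  (forall N, `|\sum_(0 <= k < N) T k| <= eps * N%:R + C) -> density R T g -> `|g| <= eps.
Proof.
move=> eps0 hB h; apply/ler_addgt0Pr => e e0; rewrite leNgt; apply/negP => lt.
have e3 : 0 < e / 2 by lra.
have [C' hC] := h _ e3.
have [N0 hN] := absorb_constant R (e / 2) (C + C' + 1) e3.
have := hC N0; have := hN N0 (leqnn _); have := hB N0.
set S := \sum_(_ <= _ < _) _ => h1 h2 h3.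
have : N0%:R * `|g| <= eps * N0%:R + C + (e / 2 * N0%:R + C').
  rewrite -{1}[N0%:R]normr_nat -normrM.
  have -> : N0%:R * g = S - (S - N0%:R * g) by ring.
  by apply: le_trans (ler_normB _ _) _; apply: lerD.
have : N0%:R * (eps + e) <= N0%:R * `|g| by rewrite ler_wpM2l // ltW.
lra.
Qed.
End DensityBound.

Section Orbit.
Variables (R : realType) (x : nat -> bool).

(** The word [x], continued by [false] to the left, seen from position [j]; any
    given window around the origin shows a subword of [x] once [j] is large. *)
Definition orbit (j : nat) : config :=
  fun i => if (j%:Z + i) is Posz n then x n else false.

Definition visits (E : set config) (j : nat) : bool := `[< E (orbit j) >].

Definition set_density (E : set config) (g : R) := density R (fun j => (visits E j)%:R) g.

(** Membership in [E] is decided by the coordinates from [-l] to [l]. *)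
Definition window l (E : set config) := forall y z : config,
  (forall i : int, (`|i| <= l)%N -> y i = z i) -> E y -> E z.

Lemma orbitE j l i : (`|i| <= l)%N -> orbit (j + l) i = x (j + absz (l%:Z + i)%R)%N.
Proof.
move=> il; rewrite /orbit.
by have -> : (j + l)%:Z + i = Posz (j + absz (l%:Z + i)%R)%N by lia.
Qed.

Lemma orbit_shift j n : (fun i => orbit j (i + n%:Z)) = orbit (j + n) :> config.
Proof. by apply: funext => i; rewrite /orbit; congr (if _ is Posz n then _ else _); lia. Qed.

Lemma window_local l E : window l E -> local_at x (2 * l + 1) (fun j => visits E (j + l)).
Proof.
move=> wE i j ij; apply: asbool_equiv_eq.
have agree k : (`|k| <= l)%N -> orbit (i + l) k = orbit (j + l) k.
  by move=> kl; rewrite !orbitE // ij //; lia.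
by split; apply: wE => k kl; rewrite agree.
Qed.

Lemma abs_coord k : (`|coord k| <= k)%N.
Proof. by rewrite /coord; case: ifP => ok; have := odd_double_half k; rewrite ok; lia. Qed.

Lemma window_cylinder s : window (size s) (cylinder s).
Proof.
move=> y z yz ys i lt; rewrite -yz ?ys //.
by apply: leq_trans (abs_coord i) (ltnW lt).
Qed.

Lemma window_le l l' E : (l <= l')%N -> window l E -> window l' E.
Proof. by move=> ll wE y z yz; apply: wE => i il; apply: yz; apply: leq_trans ll. Qed.

Hypothesis frequencies : forall l F, local_at x l F -> exists g : R, uniform_frequency R F g.

Lemma window_has_density l E : window l E -> exists g, set_density E g.
Proof.
move=> wE; have [g hg] := frequencies _ _ (window_local l E wE).
exists g; apply/(density_shift R _ l); last exact: uniform_frequency_density hg.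
by move=> k; case: (visits _ _); rewrite ?normr0 ?normr1.
Qed.

Lemma set_density_disjoint E E' g g' : E `&` E' = set0 ->
  set_density E g -> set_density E' g' -> set_density (E `|` E') (g + g').
Proof.
move=> EE h h'; apply: eq_density (densityD R _ _ _ _ h h') => j.
rewrite /visits asbool_or -natrD; congr (_%:R).
case: asboolP => [h1|h1]; case: asboolP => [h2|h2] //.
by have : (E `&` E') (orbit j) by []; rewrite EE.
Qed.

Lemma cylinder_split s : cylinder s = cylinder (rcons s false) `|` cylinder (rcons s true).
Proof.
rewrite !cylinder_rcons -setIUr [X in _ `&` X](_ : _ = setT) ?setIT //.
by apply/seteqP; split => // y _ /=; case: (y _ : bool); [right|left].
Qed.

Lemma cylinder_split_disjoint s : cylinder (rcons s false) `&` cylinder (rcons s true) = set0.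
Proof.
rewrite !cylinder_rcons; apply/seteqP; split => // y [[_ /= ->] [_ /= h]].
by have : false = true by exact: h.
Qed.

Lemma orbit_measure_exists : exists P : probability (borel_shift bool) R,
  forall s g, set_density (cylinder s) g -> P (cylinder s) = g%:E.
Proof.
have h s := window_has_density _ _ (window_cylinder s).
have [g hg] := choice h.
have [|||P hP] := @tree_measure_exists R g.
- by move=> s; apply: density_ge0 (hg s) => k; rewrite ler0n.
- apply: density_unique (hg [::]) _; apply: eq_density (density_cst R 1) => j.
  by rewrite /visits cylinder_nil asboolT.
- move=> s; apply: density_unique (hg s) _; rewrite cylinder_split.
  exact: set_density_disjoint (cylinder_split_disjoint s) (hg _) (hg _).
by exists P => s g' hg'; rewrite hP (density_unique R _ _ _ (hg s) hg').
Qed.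

Variable P : probability (borel_shift bool) R.
Hypothesis P_cylinder : forall s g, set_density (cylinder s) g -> P (cylinder s) = g%:E.

(** Both the measure and the density are additive along [cylinder_split], and
    sufficiently deep cylinders are either contained in [E] or disjoint from it. *)
Lemma window_measure l E : window l E ->
  measurable (E : set (borel_shift bool)) /\ exists2 g, set_density E g & P E = g%:E.
Proof.
(* coord_index is below this bound on [-l, l] *)
move=> wE; pose n := (2 * l + 2)%N.
suff key k s : (size s + k = n)%N ->
    measurable (E `&` cylinder s : set (borel_shift bool)) /\
    exists2 g, set_density (E `&` cylinder s) g & P (E `&` cylinder s) = g%:E.
  by have := key n [::] (add0n _); rewrite cylinder_nil setIT.
elim: k s => [|k IH] s sn.
  have [[y [Ey ys]]|none] := pselect (exists y, E y /\ cylinder s y).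
    have -> : E `&` cylinder s = cylinder s.
      apply/seteqP; split => [z []//|z zs]; split=> //.
      apply: wE Ey => i il; rewrite -(coord_indexK i).
      have lt : (coord_index i < size s)%N.
        by move: sn il; rewrite addn0 /n => ->; case: i => i /=; lia.
      by rewrite ys // zs.
    split; first exact: measurable_cylinder.
    have [g hg] := window_has_density _ _ (window_cylinder s).
    by exists g => //; exact: P_cylinder.
  have -> : E `&` cylinder s = set0.
    by apply/seteqP; split => // z [Ez zs]; apply: none; exists z.
  split; first exact: measurable0.
  exists 0; last exact: measure0.
  by apply: eq_density (density_cst R 0) => j; rewrite /visits asboolF.
have [m0 [g0 h0 P0]] := IH (rcons s false) ltac:(by rewrite size_rcons; lia).
have [m1 [g1 h1 P1]] := IH (rcons s true) ltac:(by rewrite size_rcons; lia).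
have dis : (E `&` cylinder (rcons s false)) `&` (E `&` cylinder (rcons s true)) = set0.
  by rewrite setIACA cylinder_split_disjoint setI0.
rewrite cylinder_split setIUr; split; first exact: measurableU.
exists (g0 + g1); first exact: set_density_disjoint.
apply: etrans (measureU P m0 m1 dis) _; rewrite EFinD.
by congr (_ + _)%E; [exact: P0 | exact: P1].
Qed.

Lemma window_measureE l E g : window l E -> set_density E g -> P E = g%:E.
Proof.
by move=> /window_measure[_ [g' h' ->]] h; rewrite (density_unique R _ _ _ h' h).
Qed.

End Orbit.

(** * Passing from cylinders to measurable sets *)

Section DynkinLimit.
Variables (R : realType) (P : probability Omega R) (nu : nat -> set Omega -> R) (b : R).
Let p (A : set Omega) := fine (P A).
Hypothesis nu_bounds : forall n A, measurable A -> 0 <= nu n A <= p A.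
Hypothesis nu_add : forall n A B, measurable A -> measurable B -> A `&` B = set0 ->
  nu n (A `|` B) = nu n A + nu n B.
Hypothesis nu_setT : nu n setT @[n --> \oo] --> b.
Hypothesis nu_cylinders : forall A, cylinders A -> nu n A @[n --> \oo] --> b * p A.

Let PE A : measurable A -> P A = (p A)%:E.
Proof. by move=> mA; rewrite /p fineK // fin_num_measure. Qed.

Let p_add A B : measurable A -> measurable B -> A `&` B = set0 -> p (A `|` B) = p A + p B.
Proof.
move=> mA mB AB; rewrite /p (measureU P) // fineD //; exact: fin_num_measure.
Qed.

(** Countable unions are the only delicate step: the domination of every
    [nu n] by [P] makes the tails small uniformly in [n]. *)
Lemma dynkin_limit A : measurable A -> nu n A @[n --> \oo] --> b * p A.
Proof.
rewrite measurable_cylindersE; move: A.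
apply: (@dynkin_induction _ Omega cylinders).
- exact: measurable_cylindersE.
- exact: setI_closed_cylinders.
- by rewrite /p probability_setT /= mulr1.
- exact: nu_cylinders.
- move=> A mA hA.
  have mAC := measurableC mA.
  have -> : (fun n => nu n (~` A)) = (fun n => nu n setT - nu n A).
    apply/funext => n; rewrite -(setUv A) nu_add ?setICr //; lra.
  have -> : b * p (~` A) = b - b * p A.
    have := p_add A (~` A) mA mAC (setICr A).
    rewrite setUv /p probability_setT /= => h.
    have -> : fine (P (~` A)) = 1 - fine (P A) by rewrite h addrC addKr.
    by ring.
  exact: cvgB.
move=> F mF tF hF; set U := \bigcup_k F k.
have mU : measurable U by exact: bigcup_measurable.
pose V K := \big[setU/set0]_(i < K) F i.
have mV K : measurable (V K) by apply: bigsetU_measurable.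
have VS K : V K.+1 = V K `|` F K by rewrite /V big_ord_recr.
have dis K : V K `&` F K = set0.
  rewrite /V -bigcup_mkord; apply/seteqP; split => // y [[i /= iK Fi] FK].
  by have := tF i K I I (ex_intro _ y (conj Fi FK)) => e; rewrite e ltnn in iK.
have nuV n K : nu n (V K.+1) = nu n (V K) + nu n (F K) by rewrite VS nu_add.
have pV K : p (V K.+1) = p (V K) + p (F K) by rewrite VS p_add.
have V0 : V 0%N = set0 by rewrite /V big_ord0.
have p0 : p set0 = 0 by rewrite /p measure0.
have hV K : nu n (V K) @[n --> \oo] --> b * p (V K).
  elim: K => [|K IH].
    rewrite V0 p0 mulr0; apply: cvg_near_cst; apply: nearW => n.
    by apply/eqP; rewrite eq_le andbC; have := nu_bounds n set0 measurable0; rewrite p0.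
  rewrite pV mulrDr; under eq_fun do rewrite nuV; exact: cvgD.
have VU K : V K `<=` U.
  by rewrite /V -bigcup_mkord => y [i _ Fi]; exists i.
have split_nu n K : nu n U = nu n (V K) + nu n (U `\` V K).
  rewrite -nu_add //; first by rewrite setDUK.
  - exact: measurableD.
  - exact: setDIK.
have split_p K : p U = p (V K) + p (U `\` V K).
  rewrite -p_add //; first by rewrite setDUK.
  - exact: measurableD.
  - exact: setDIK.
have pcvg : p (V K) @[K --> \oo] --> p U.
  have sumE K : (\sum_(0 <= i < K) P (F i))%E = (p (V K))%:E.
    elim: K => [|K IH]; first by rewrite big_geq // V0 p0.
    by rewrite big_nat_recr //= IH PE // pV EFinD.
  have := @measure_semi_sigma_additive _ _ _ P F mF tF mU.
  under eq_fun do rewrite sumE.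
  rewrite -[X in _ --> X]/(P U) (PE U mU) => /fine_cvg; exact: cvg_trans.
apply/cvgrPdist_le => eps eps0.
(* the tail enters once through nu and once through b * p, hence the factor `|b| + 1 *)
have e1 : 0 < eps / (2 * (`|b| + 1)) by rewrite divr_gt0 ?mulr_gt0 ?ltr_wpDl.
have e2 : 0 < eps / 2 by lra.
move/cvgrPdist_le : pcvg => /(_ _ e1) [K _ /(_ K (leqnn K)) /= hK].
move/cvgrPdist_le : (hV K) => /(_ _ e2); apply: filterS => n hn.
have mD : measurable (U `\` V K) by exact: measurableD.
have /andP[n1 n2] := nu_bounds n _ mD.
have pd0 : 0 <= p (U `\` V K) by rewrite /p fine_ge0.
move: hK; rewrite (split_p K) [X in `|X|]addrC addKr ger0_norm // => hK.
rewrite (split_nu n K).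
have -> : b * (p (V K) + p (U `\` V K)) - (nu n (V K) + nu n (U `\` V K)) =
  (b * p (V K) - nu n (V K)) + (b * p (U `\` V K) - nu n (U `\` V K)) by ring.
apply: le_trans (ler_normD _ _) _.
have : `|b * p (U `\` V K) - nu n (U `\` V K)| <= eps / 2.
  apply: le_trans (ler_normB _ _) _; rewrite normrM (ger0_norm pd0) (ger0_norm n1).
  apply: le_trans (_ : (`|b| + 1) * p (U `\` V K) <= _).
    by rewrite mulrDl mul1r lerD2l.
  rewrite mulrC -ler_pdivlMr ?ltr_wpDl //.
  by move: hK; rewrite invfM mulrA.
lra.
Qed.
End DynkinLimit.

(** * Dynamics of the orbit closure *)

Definition translate (c : int) (y : config) : config := fun i => y (i + c).

Lemma translateD c d y : translate c (translate d y) = translate (c + d) y.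
Proof. by apply/funext => i; rewrite /translate addrA. Qed.

Lemma translate0 y : translate 0 y = y.
Proof. by apply/funext => i; rewrite /translate addr0. Qed.

Lemma iter_shift n (y : config) : iter n shift_map y = translate n%:Z y.
Proof.
elim: n => [|n IH]; first by rewrite translate0.
by rewrite iterS IH; apply/funext => i; rewrite /shift_map /translate -addrA; congr (y _).
Qed.

Lemma window_translate c l E : window l E -> window (l + absz c) (translate c @^-1` E).
Proof. by move=> wE y z yz; apply: wE => i il; apply: yz; lia. Qed.

Section Dynamics.
Variables (R : realType) (x : nat -> bool).
Hypothesis frequencies : forall l F, local_at x l F -> exists g : R, uniform_frequency R F g.
Hypothesis mixing : forall lF F lG G (g eps : R),
  local_at x lF F -> local_at x lG G -> uniform_frequency R G g -> 0 < eps ->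
  exists t0, forall t, (t0 <= t)%N -> exists C : R, forall N,
    `|\sum_(0 <= k < N) (F k)%:R * ((G (k + t)%N)%:R - g)| <= eps * N%:R + C.
Variable P : probability Omega R.
Hypothesis P_cylinder : forall s g, set_density R x (cylinder s) g -> P (cylinder s) = g%:E.

Let wmeas := @window_measure R x frequencies P P_cylinder.

Lemma visits_le1 E j : `|(visits x E j)%:R : R| <= 1.
Proof. by case: (visits _ _ _); rewrite ?normr0 ?normr1. Qed.

Lemma measurable_translate c : measurable_fun setT (translate c : Omega -> Omega).
Proof.
apply: (@measurability _ _ _ Omega setT _ cylinders); first exact: measurable_cylindersE.
move=> _ [_ [->|[s ->]] <-]; rewrite setTI; first by rewrite preimage_set0; exact: measurable0.
by have [] := wmeas _ _ (window_translate c _ _ (window_cylinder s)).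
Qed.

Lemma measurable_preimage_translate c (B : set Omega) :
  measurable B -> measurable (translate c @^-1` B : set Omega).
Proof. by move=> mB; rewrite -[X in measurable X]setTI; exact: measurable_translate. Qed.

Lemma visits_translate n E j : visits x (translate n%:Z @^-1` E) j = visits x E (j + n).
Proof. by rewrite /visits /= -orbit_shift. Qed.

Lemma set_density_translate n E g :
  set_density R x E g -> set_density R x (translate n%:Z @^-1` E) g.
Proof.
move=> h; apply: eq_density (iffRL (density_shift R _ n g (visits_le1 E)) h) => j.
by rewrite visits_translate.
Qed.

Lemma translate_invariant n (B : set Omega) : measurable B ->
  P (translate n%:Z @^-1` B) = P B.
Proof.
rewrite measurable_cylindersE; move: B.
apply: (@dynkin_induction _ Omega cylinders).
- exact: measurable_cylindersE.
- exact: setI_closed_cylinders.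
- by rewrite preimage_setT.
- move=> _ [->|[s ->]]; first by rewrite preimage_set0.
  have ws := window_cylinder s; have [_ [g hg ->]] := wmeas _ _ ws.
  apply: (window_measureE _ _ frequencies _ P_cylinder _ _ _ (window_translate n%:Z _ _ ws)).
  exact: set_density_translate.
- move=> B mB hB; rewrite preimage_setC !probability_setC //; first by rewrite hB.
  exact: measurable_preimage_translate.
- move=> F mF tF hF; rewrite preimage_bigcup.
  rewrite !measure_semi_bigcup //; first by apply: eq_eseriesr => k _; exact: hF.
  + exact: bigcup_measurable.
  + by move=> k; exact: measurable_preimage_translate.
  + by apply/trivIsetP => i j _ _ ij; rewrite -preimage_setI;
      move/trivIsetP : tF => /(_ _ _ _ _ ij) -> //; rewrite preimage_set0.
  + by apply: bigcup_measurable => k _; exact: measurable_preimage_translate.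
Qed.

Let p (A : set Omega) : R := fine (P A).

(** Along the orbit, the density of the intersection minus the product of the
    densities is the mean of [F k * (G (k + n) - g')], which [mixing] bounds. *)
Lemma mixing_windows l E l' E' : window l E -> window l' E' ->
  p (E `&` translate n%:Z @^-1` E') @[n --> \oo] --> p E * p E'.
Proof.
move=> wE wE'; pose L := maxn l l'.
have wE1 : window L E by apply: window_le wE; exact: leq_maxl.
have wE1' : window L E' by apply: window_le wE'; exact: leq_maxr.
have [_ [g hg gE]] := wmeas _ _ wE; have [_ [g' hg' gE']] := wmeas _ _ wE'.
pose F j := visits x E (j + L); pose G j := visits x E' (j + L).
have Fl : local_at x (2 * L + 1) F by exact: window_local.
have Gl : local_at x (2 * L + 1) G by exact: window_local.
have dF : density R (fun j => (F j)%:R) g by exact: (iffRL (density_shift R _ L g (visits_le1 E)) hg).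
have [g1 hg1] := frequencies _ _ Gl.
have g1E : g1 = g'.
  apply: density_unique hg'; apply: (iffLR (density_shift R _ L g1 (visits_le1 E'))).
  exact: uniform_frequency_density.
rewrite g1E in hg1.
rewrite /p gE gE' /=; apply/cvgrPdist_le => eps eps0.
have [t0 ht] := mixing _ _ _ _ _ _ Fl Gl hg1 eps0.
exists t0 => // t /= tt0; have [C hC] := ht t tt0.
have wI : window (L + (L + absz t%:Z)) (E `&` translate t%:Z @^-1` E').
  move=> y z yz [Ey E'y]; split; first by apply: (wE1 y) => // i il; apply: yz; lia.
  by apply: (window_translate t%:Z _ _ wE1' y) => // i il; apply: yz; lia.
have [_ [d hd ->]] := wmeas _ _ wI.
have hFG : density R (fun j => (F j)%:R * ((G (j + t)%N)%:R - g')) (d + (- g') * g).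
  apply: (eq_density _ (fun j => (F j && G (j + t)%N)%:R + (- g') * (F j)%:R)).
    by move=> j; case: (F j); case: (G _) => /=; ring.
  apply: densityD; last exact: density_scale.
  apply: (eq_density _ _ _ _ _ (iffRL (density_shift R _ L d (visits_le1 _)) hd)) => j.
  rewrite /visits asbool_and; congr (nat_of_bool (_ && _))%:R.
  by rewrite -/(visits x (translate t%:Z @^-1` E') (j + L)) visits_translate /G /visits addnAC.
rewrite distrC /=; have := density_bound R _ _ _ _ (ltW eps0) hC hFG.
by rewrite mulNr [g' * g]mulrC.
Qed.

Let P_fin (A : set Omega) : measurable A -> P A = (p A)%:E.
Proof. by move=> mA; rewrite /p fineK // fin_num_measure. Qed.

Let p_ge0 (A : set Omega) : 0 <= p A. Proof. by rewrite /p fine_ge0. Qed.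

Let p_le (A B : set Omega) : measurable A -> measurable B -> A `<=` B -> p A <= p B.
Proof.
by move=> mA mB AB; rewrite /p fine_le ?fin_num_measure // le_measure ?inE.
Qed.

Let pU (A B : set Omega) : measurable A -> measurable B -> A `&` B = set0 ->
  p (A `|` B) = p A + p B.
Proof. by move=> mA mB AB; rewrite /p (measureU P) // fineD //; exact: fin_num_measure. Qed.

Lemma mixing_left_cylinder s (C : set Omega) : measurable C ->
  p (cylinder s `&` translate n%:Z @^-1` C) @[n --> \oo] --> p (cylinder s) * p C.
Proof.
move=> mC; have ms : measurable (cylinder s : set Omega) by exact: measurable_cylinder.
apply: (dynkin_limit R P (fun n A => p (cylinder s `&` translate n%:Z @^-1` A))) mC => //.
- move=> n A mA; have mtA := measurable_preimage_translate n%:Z A mA.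
  rewrite p_ge0 /= -(translate_invariant n A mA) p_le //; exact: measurableI.
- move=> n A B mA mB AB.
  have mtA := measurable_preimage_translate n%:Z A mA.
  have mtB := measurable_preimage_translate n%:Z B mB.
  rewrite preimage_setU setIUr pU //; [exact: measurableI|exact: measurableI|].
  by rewrite setIACA -preimage_setI AB preimage_set0 setI0.
- rewrite (_ : (fun n => _) = fun=> p (cylinder s)); first exact: cvg_cst.
  by apply/funext => n; rewrite preimage_setT setIT.
- move=> A [->|[t ->]].
    rewrite (_ : (fun n => _) = fun=> 0); last first.
      by apply/funext => n; rewrite preimage_set0 setI0 /p measure0.
    by rewrite measure0 /= mulr0; exact: cvg_cst.
  exact: mixing_windows (window_cylinder s) (window_cylinder t).
Qed.

(** Two successive applications of [dynkin_limit], one for each set; the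
    first is [mixing_left_cylinder]. *)
Lemma mixing_measurable (B C : set Omega) : measurable B -> measurable C ->
  p (B `&` translate n%:Z @^-1` C) @[n --> \oo] --> p B * p C.
Proof.
move=> mB mC; rewrite mulrC.
have mtC n := measurable_preimage_translate n%:Z C mC.
apply: (dynkin_limit R P (fun n A => p (A `&` translate n%:Z @^-1` C))) mB => //.
- move=> n A mA; rewrite p_ge0 /= p_le //; exact: measurableI.
- move=> n A B' mA mB' AB; rewrite setIUl pU //; [exact: measurableI|exact: measurableI|].
  by rewrite setIACA AB set0I.
- rewrite (_ : (fun n => _) = fun=> p C); first exact: cvg_cst.
  by apply/funext => n; rewrite setTI /p translate_invariant.
- move=> A [->|[s ->]].
    rewrite (_ : (fun n => _) = fun=> 0); last first.
      by apply/funext => n; rewrite set0I /p measure0.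
    by rewrite measure0 /= mulr0; exact: cvg_cst.
  by rewrite mulrC; exact: mixing_left_cylinder.
Qed.

Lemma P_shift_invariant : shift_invariant P.
Proof.
move=> B mB; rewrite -[RHS](translate_invariant 1 B mB).
by congr (P _); apply/seteqP; split.
Qed.

Lemma iter_shift_image n (B : set config) :
  iter n shift_map @` B = translate (- n%:Z) @^-1` B.
Proof.
apply/seteqP; split => [_ [y By <-]|y By] /=.
  by rewrite iter_shift translateD addNr translate0.
by exists (translate (- n%:Z) y) => //; rewrite iter_shift translateD addrN translate0.
Qed.

(** By invariance, the image of [B] under the [n]-th shift meets [C] in as much
    mass as [B] meets the preimage of [C]. *)
Lemma P_strongly_mixing : strongly_mixing P.
Proof.
move=> B C mB mC.
have mTB n : measurable (iter n shift_map @` B : set Omega).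
  by rewrite iter_shift_image; exact: measurable_preimage_translate.
have mI n : measurable ((iter n shift_map @` B) `&` C : set Omega) by exact: measurableI.
rewrite (_ : (fun n => _) = fun n => (p (B `&` translate n%:Z @^-1` C))%:E); last first.
  apply/funext => n; rewrite -(translate_invariant n _ (mI n)) iter_shift_image.
  have mtC := measurable_preimage_translate n%:Z C mC.
  rewrite -P_fin; last exact: measurableI.
  congr (P _); rewrite preimage_setI; congr (_ `&` _).
  by apply/seteqP; split => y /=; rewrite translateD addNr translate0.
rewrite (P_fin B mB) (P_fin C mC) -EFinM; apply: cvg_EFin; last exact: mixing_measurable.
by apply: nearW => n.
Qed.

(** An atom [A] would meet each translate of [Z] in measure 0 or [p A], whereas
    by mixing these measures tend to [p A * p Z], strictly in between. *)
Lemma P_nonatomic (Z : set Omega) : measurable Z -> 0 < p Z < 1 -> nonatomic P.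
Proof.
move=> mZ /andP[z0 z1] A [mA A0 hA].
have a0 : 0 < p A by rewrite -lte_fin -P_fin.
(* half the distance from p A * p Z to the nearest of 0 and p A *)
pose eps := p A * Num.min (p Z) (1 - p Z) / 2.
have m0 : 0 < Num.min (p Z) (1 - p Z) by rewrite lt_min z0 subr_gt0 z1.
have eps0 : 0 < eps by rewrite /eps divr_gt0 // mulr_gt0.
have /cvgrPdist_le/(_ _ eps0)[n _ /(_ n (leqnn _)) /=] := mixing_measurable A Z mA mZ.
set B := A `&` _.
have mB : measurable B by apply: measurableI => //; exact: measurable_preimage_translate.
have BA : B `<=` A by exact: subIsetl.
have le1 : p A * Num.min (p Z) (1 - p Z) <= p A * p Z by rewrite ler_wpM2l ?(ltW a0) // ge_min lexx.
have le2 : p A * Num.min (p Z) (1 - p Z) <= p A * (1 - p Z).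
  by rewrite ler_wpM2l ?(ltW a0) // ge_min lexx orbT.
have [lt|ge] := ltP (p B) (p A).
  have ltBA : (P B < P A)%E by rewrite (P_fin B mB) (P_fin A mA) lte_fin.
  have : P B = 0%E by exact: hA mB BA ltBA.
  rewrite (P_fin B mB) => -[->]; rewrite subr0 ger0_norm; last by rewrite mulr_ge0 ?ltW.
  by move: eps0; rewrite /eps; lra.
have -> : p B = p A by apply/eqP; rewrite eq_le ge p_le.
rewrite ler_norml => /andP[h _]; move: h eps0; rewrite /eps; lra.
Qed.

Definition occurs_at (i : int) q : set config :=
  [set y : config | exists j, forall k, (k < q)%N -> y (i + k%:Z) = x (j + k)%N].

(** The orbit closure of the one-sided word [x]: subwords are compared with [x]
    itself and not with the two-sided continuation in [orbit]. *)
Definition word_shift : set config := [set y | forall i q, occurs_at i q y].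

Lemma window_occurs i q : window (absz i + q) (occurs_at i q).
Proof. by move=> y z yz [j h]; exists j => k kq; rewrite -yz ?h //; lia. Qed.

Lemma cylinder_open s : open (cylinder s).
Proof.
elim/last_ind: s => [|s b IH]; first by rewrite cylinder_nil; exact: openT.
by rewrite cylinder_rcons; apply: openI => //; exact: open_coordinate.
Qed.

Lemma cylinder_prefix_agree y z l : cylinder (prefix_word y (2 * l + 2)) z ->
  forall i : int, (`|i| <= l)%N -> y i = z i.
Proof.
move=> h i il; have := h (coord_index i); rewrite size_mkseq.
have lt : (coord_index i < 2 * l + 2)%N by move: il; case: i {h} => i /=; lia.
by rewrite nth_mkseq // coord_indexK => /(_ lt) ->.
Qed.

Lemma window_open l E : window l E -> open E.
Proof.
move=> wE; rewrite (_ : E = \bigcup_(s in [set s | cylinder s `<=` E]) cylinder s).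
  by apply: bigcup_open => s _; exact: cylinder_open.
apply/seteqP; split => [y Ey|y [s sE] /sE //].
exists (prefix_word y (2 * l + 2)); last exact: cylinder_prefix.
by move=> z /cylinder_prefix_agree h; exact: (wE y).
Qed.

Lemma window_setC l E : window l E -> window l (~` E).
Proof. by move=> wE y z yz Ey Ez; apply: Ey; apply: wE Ez => i il; rewrite yz. Qed.

Lemma word_shift_setC : ~` word_shift = \bigcup_k \bigcup_q ~` occurs_at (coord k) q.
Proof.
apply/seteqP; split => [y|y [k _ [q _ h]] hy]; last exact: h (hy _ _).
move=> /existsNP[i /existsNP[q h]]; exists (coord_index i) => //; exists q => //.
by rewrite coord_indexK.
Qed.

Lemma word_shift_closed : closed word_shift.
Proof.
rewrite -openC word_shift_setC; apply: bigcup_open => k _; apply: bigcup_open => q _.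
exact: window_open (window_setC _ _ (window_occurs _ _)).
Qed.

Lemma word_shift_subshift : subshift word_shift.
Proof.
split; first exact: word_shift_closed.
have inv c y : word_shift y -> word_shift (translate c y).
  move=> h i q; have [j hj] := h (i + c) q; exists j => k kq.
  by rewrite -hj // /translate addrAC.
apply/seteqP; split => [_ [y hy <-]|y hy]; first exact: (inv 1 y hy).
by exists (translate (-1) y); [exact: inv|apply/funext => i; rewrite /shift_map /translate addrK].
Qed.

(** The orbit visits [~` occurs_at i q] only while the window sticks out to the
    left of the origin, so these countably many sets have density 0. *)
Lemma P_word_shift : P word_shift = 1%E.
Proof.
have null i q : P (~` occurs_at i q) = 0%E.
  apply: (window_measureE _ _ frequencies _ P_cylinder _ _ _
    (window_setC _ _ (window_occurs i q))).
  apply: (density_eventually0 _ _ (absz i)); last exact: visits_le1.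
  move=> j ij; rewrite /visits asboolF //; apply; exists (absz (j%:Z + i)) => k kq.
  rewrite /orbit.
  by have -> : j%:Z + (i + k%:Z) = Posz (absz (j%:Z + i)%R + k)%N by lia.
have mN i q : measurable (~` occurs_at i q : set Omega).
  by have [] := wmeas _ _ (window_setC _ _ (window_occurs i q)).
have mC : measurable (~` word_shift : set Omega).
  by apply: measurable_open; rewrite openC; exact: word_shift_closed.
have PC : P (~` word_shift) = 0%E.
  apply/(measure_negligible mC).
  rewrite word_shift_setC; apply: negligible_bigcup => k; apply: negligible_bigcup => q.
  by apply/negligibleP => //; exact: null.
have := probability_setC P mC; rewrite setCK PC sube0; exact.
Qed.

Lemma complexity_word_shift q (W : seq (seq bool)) :
  (forall i, mkseq (fun k => x (i + k)%N) q \in W) ->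
  (complexity word_shift q <= size W)%N.
Proof.
move=> hW; rewrite /complexity cardE -(size_map val).
apply: uniq_leq_size; first by rewrite map_inj_uniq ?enum_uniq //; exact: val_inj.
move=> _ /mapP[w + ->]; rewrite mem_enum => /asboolP[y hy [i wE]].
have [j hj] := hy i q.
have -> : \val w = mkseq (fun k => x (j + k)%N) q; last exact: hW.
apply: etrans wE _; rewrite size_tuple.
by apply: (@eq_from_nth _ false); rewrite ?size_mkseq // => k kq; rewrite !nth_mkseq // hj.
Qed.
End Dynamics.

Theorem theorem1 (R : realType) (f : nat -> nat)
    (f_superlinear : ((f q)%:R / q%:R : R) @[q --> \oo] --> +oo) :
  exists (A : pfinType) (X : set (full_shift A))
         (mu : probability (borel_shift A) R),
    [/\ subshift X,
        [/\ mu X = 1%E, nonatomic mu, shift_invariant mu & strongly_mixing mu] &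
        ((complexity X q)%:R / (f q)%:R : R) @[q --> \oo] --> (0 : R)].
Proof.
have fsl : superlinear f.
  move=> k; move/cvgryPge : f_superlinear => /(_ k%:R) [q0 _ hq].
  exists q0 => q q0q; case: q q0q => [|q] q0q; first by rewrite muln0.
  have := hq q.+1 q0q; rewrite /= ler_pdivlMr ?ltr0n // -natrM ler_nat; exact.
have [x [freq mix [g gx g01] comp]] := mixing_word_exists R f fsl.
have [P hP] := orbit_measure_exists R x freq.
exists bool, (word_shift x), P; split; first exact: word_shift_subshift.
  pose Z : set config := [set y : config | y 0 = true].
  have wZ : window 0 Z by move=> y z yz Zy; rewrite /Z /= -yz.
  have dZ : set_density R x Z g.
    apply: eq_density (uniform_frequency_density R x g gx) => j.
    congr (nat_of_bool _)%:R; rewrite /visits /Z /= /orbit addr0.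
    exact: esym (asboolb (x j)).
  have [mZ _] := window_measure R x freq P hP 0 Z wZ.
  have PZ := window_measureE R x freq P hP 0 Z g wZ dZ.
  split.
  - exact: P_word_shift.
  - by apply: (P_nonatomic R x freq mix P hP Z mZ); rewrite PZ.
  - exact: (P_shift_invariant R x freq P hP).
  - exact: (P_strongly_mixing R x freq mix P hP).
apply/cvgrPdist_le => eps eps0.
have [K hK] := absorb_constant R eps 1 eps0.
have [q0 hq] := comp K.+1.
exists q0 => // q /= q0q; have [W [WK hW]] := hq q q0q.
have := complexity_word_shift x q W hW; set c := complexity _ _ => cW.
rewrite sub0r normrN ger0_norm ?divr_ge0 //.
have [->|fq] := posnP (f q); first by rewrite invr0 mulr0 ltW.
rewrite ler_pdivrMr ?ltr0n //.
apply: le_trans (_ : eps * K.+1%:R * c%:R <= _).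
  by rewrite ler_peMl // hK.
rewrite -mulrA ler_wpM2l ?(ltW eps0) // -natrM ler_nat.
by apply: leq_trans WK; rewrite leq_mul2l cW orbT.
Qed.
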